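(* Let $n$ be even and $N=n+1\ge3$. Then $$\operatorname{Res}_{n=N-1}(\mathbf{Q}_N)=(-1)^{n-1}\,n!\,(n+1)!\,\frac{n}{2}\,\mathcal{B}_n ,$$ where on the right-hand side $n=N-1$, $\mathcal{B}_n$ is the singular Yamabe obstruction of $M^n$, and the left-hand side is the formal residue, at $n=N-1$, of the extrinsic $Q$-curvature $\mathbf{Q}_N$ regarded as a function of the dimension $n$.
   Context: Setting: $(X,g)$ is a compact Riemannian manifold of dimension $n+1$ with boundary $M$ of dimension $n$, $\iota:M\hookrightarrow X$ the inclusion, $r$ the distance function of $M$ with respect to $g$. $\Delta_g=\operatorname{div}\operatorname{grad}$. For a boundary defining function $\sigma$ (i.e. $\sigma^{-1}(0)=M$, $\sigma>0$ on $X\setminus M$, $d\sigma|_M\neq0$) put $2n\,\mathsf{J}=\operatorname{scal}(g)$, $(n+1)\rho=-\Delta_g(\sigma)-\sigma\mathsf{J}$, $\mathcal{S}(g,\sigma)=|d\sigma|_g^2+2\sigma\rho$, $L(g,\sigma;\lambda)=(n+2\lambda-1)(\nabla_{\operatorname{grad}_g(\sigma)}+\lambda\rho)-\sigma(\Delta_g+\lambda\mathsf{J})$. Obstruction: there are unique $\sigma_{(k)}\in C^\infty(M)$, $2\le k\le n+1$, such that $\sigma_F=r+\sigma_{(2)}r^2+\dots+\sigma_{(n+1)}r^{n+1}$ (in geodesic normal coordinates $(r,x)$ near $M$) satisfies $\mathcal{S}(g,\sigma_F)=1+Rr^{n+1}$ with smooth $R$; $\mathcal{B}_n=R|_{r=0}$.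 Extrinsic $Q$-curvature: if $N\le n$ and $\sigma$ satisfies $\mathcal{S}(g,\sigma)=1+\sigma^{n+1}R_{n+1}$ with $R_{n+1}$ smooth up to the boundary, then $$\mathbf{Q}_N=-\iota^*L\big(g,\sigma;\tfrac{-n-N}{2}+1\big)\circ\cdots\circ L\big(g,\sigma;\tfrac{-n+N}{2}-1\big)\big((N-1)\rho-\sigma\mathsf{J}\big)\in C^\infty(M)$$ (parameters increasing by $1$ from left to right). It is given by a universal formula in terms of $g$ and the embedding whose coefficients are rational functions of the dimension $n$; this formula has a pole at $n=N-1$. Meaning of the residue: $\operatorname{Res}_{n=N-1}(\mathbf{Q}_N)$ is the residue at $n=N-1$ of the coefficients of this universal formula, evaluated on hypersurfaces of dimension $N-1$. Explicitly, for $M$ of dimension $N-1$: replace each explicitly occurring number $n$ in the definitions of $\mathsf{J},\rho,\mathcal{S},L$ and in the parameters $\frac{-n\pm N}{2}$ in the formula for $\mathbf{Q}_N$ by an indeterminate $d$ (keeping $g$, $\Delta_g$, $\operatorname{scal}(g)$, gradients unchanged); solve $\mathcal{S}_d(g,\sigma)=1+O(r^{N+1})$ recursively for $\sigma=r+\sigma_{(2)}(d)r^2+\dots+\sigma_{(N+1)}(d)r^{N+1}$ with coefficients rational in $d$; insert this $\sigma$ in the formula for $\mathbf{Q}_N$ to obtain a rational function of $d$ with values in $C^\infty(M)$, and take its residue at $d=N-1$. *)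

(* Defs.v *)
From HB Require Import structures.
From mathcomp Require Import all_boot all_order all_algebra.
From mathcomp Require Import all_classical all_reals all_analysis.

Set Implicit Arguments.
Unset Strict Implicit.
Unset Printing Implicit Defensive.

Import Order.TTheory GRing.Theory Num.Theory.
Import numFieldNormedType.Exports.

Local Open Scope classical_set_scope.
Local Open Scope ring_scope.

(* A region A of R^m is all of R^m or a closed half-space.  All limits are taken inside A, so
   that derivatives transversal to the boundary are one-sided there. *)

Definition diffquot (R : realType) (m : nat) (k : 'I_m) (f : 'rV[R]_m -> R)
    (p : 'rV[R]_m) (h : R) : R :=
  h^-1 * (f (p + h *: delta_mx 0 k) - f p).

Definition stay (R : realType) (m : nat) (A : set 'rV[R]_m) (k : 'I_m)
    (p : 'rV[R]_m) : set R :=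
  [set h | A (p + h *: delta_mx 0 k)].

Definition pd (R : realType) (m : nat) (A : set 'rV[R]_m) (k : 'I_m)
    (f : 'rV[R]_m -> R) (p : 'rV[R]_m) : R :=
  lim (diffquot k f p h @[h --> within (stay A k p) 0^']).

(* f is smooth on S, a relatively open subset of A: every iterated partial
   derivative exists on S and is continuous there (up to the boundary). *)
Definition Cinf (R : realType) (m : nat) (A S : set 'rV[R]_m)
    (f : 'rV[R]_m -> R) : Prop :=
  forall (s : seq 'I_m) (p : 'rV[R]_m), S p ->
    foldr (pd A) f s q @[q --> within A (nbhs p)] --> foldr (pd A) f s p /\
    forall k : 'I_m,
      cvg (diffquot k (foldr (pd A) f s) p h @[h --> within (stay A k p) 0^']).

Definition halfspace (R : realType) (n : nat) : set 'rV[R]_n.+1 :=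
  [set p | 0 <= p 0 0].

(* (s, y) as a point of R^(n+1), and the component y *)
Definition pt (R : realType) (n : nat) (s : R) (y : 'rV[R]_n) : 'rV[R]_n.+1 :=
  row_mx (s%:M : 'rV[R]_1) y.

Definition tailv (R : realType) (n : nat) (z : 'rV[R]_n.+1) : 'rV[R]_n :=
  @rsubmx R 1 1 n z.

Record bmanifold (R : realType) (n : nat) (X : topologicalType) := BManifold {
  chart : Type;
  dom : chart -> set X;
  phi : chart -> X -> 'rV[R]_n.+1;
  psi : chart -> 'rV[R]_n.+1 -> X;
  bmanifold_hausdorff : hausdorff_space X;
  dom_open : forall i, open (dom i);
  dom_cover : forall x, exists i, dom i x;
  phi_img_open : forall i, exists O : set 'rV[R]_n.+1,
    open O /\ phi i @` dom i = O `&` @halfspace R n;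
  phiK : forall i x, dom i x -> psi i (phi i x) = x;
  phi_continuous : forall i, {within dom i, continuous (phi i)};
  psi_continuous : forall i, {within phi i @` dom i, continuous (psi i)};
  transition_smooth : forall i j (k : 'I_n.+1),
    Cinf (@halfspace R n) (phi i @` (dom i `&` dom j))
      (fun p => phi j (psi i p) 0 k)
}.
Arguments dom {R n X} _ _.
Arguments phi {R n X} _ _.
Arguments psi {R n X} _ _.

Definition jacobian (R : realType) (n : nat) (X : topologicalType)
    (B : bmanifold R n X) (i j : chart B) (p : 'rV[R]_n.+1) : 'M[R]_n.+1 :=
  \matrix_(a, b) pd (@halfspace R n) a (fun q => phi B j (psi B i q) 0 b) p.

Record riemannian (R : realType) (n : nat) (X : topologicalType) := Riemannian {
  mfd :> bmanifold R n X;
  met : chart mfd -> 'rV[R]_n.+1 -> 'M[R]_n.+1;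
  met_smooth : forall i (a b : 'I_n.+1),
    Cinf (@halfspace R n) (phi mfd i @` dom mfd i) (fun p => met i p a b);
  met_sym : forall i x, dom mfd i x ->
    (met i (phi mfd i x))^T = met i (phi mfd i x);
  met_pos : forall i x (v : 'rV[R]_n.+1), dom mfd i x -> v != 0 ->
    0 < (v *m met i (phi mfd i x) *m v^T) 0 0;
  met_change : forall i j x, dom mfd i x -> dom mfd j x ->
    met i (phi mfd i x) =
    jacobian i j (phi mfd i x) *m met j (phi mfd j x)
      *m (jacobian i j (phi mfd i x))^T
}.
Arguments met {R n X} _ _.

Definition bd (R : realType) (n : nat) (X : topologicalType)
    (B : bmanifold R n X) : set X :=
  [set x | exists i, dom B i x /\ phi B i x 0 0 = 0].

(* f \in C^oo(W), for W open in X *)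
Definition Cinf_on (R : realType) (n : nat) (X : topologicalType)
    (B : bmanifold R n X) (W : set X) (f : X -> R) : Prop :=
  forall i, Cinf (@halfspace R n) (phi B i @` (dom B i `&` W)) (f \o psi B i).

(* u \in C^oo(M), M = bd B; only the values of u on M matter.  The charts of M
   are the charts of X restricted to {0} x R^n. *)
Definition Cinf_bd (R : realType) (n : nat) (X : topologicalType)
    (B : bmanifold R n X) (u : X -> R) : Prop :=
  forall i, Cinf [set: 'rV[R]_n] [set y | (phi B i @` dom B i) (pt 0 y)]
    (fun y => u (psi B i (pt 0 y))).

(* (s, x) |-> F s x is smooth on the product [0, eps) x M *)
Definition Cinf_collar (R : realType) (n : nat) (X : topologicalType)
    (B : bmanifold R n X) (eps : R) (F : R -> X -> R) : Prop :=
  forall i, Cinf (@halfspace R n)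
    [set z : 'rV[R]_n.+1 | 0 <= z 0 0 < eps /\ (phi B i @` dom B i) (pt 0 (tailv z))]
    (fun z : 'rV[R]_n.+1 => F (z 0 0) (psi B i (pt 0 (tailv z)))).

Definition curve_diffquot (R : realType) (n : nat) (X : topologicalType)
    (B : bmanifold R n X) (gam : R -> X) (i : chart B) (k : 'I_n.+1)
    (t h : R) : R :=
  h^-1 * (phi B i (gam (t + h)) 0 k - phi B i (gam t) 0 k).

Definition velocity (R : realType) (n : nat) (X : topologicalType)
    (B : bmanifold R n X) (gam : R -> X) (i : chart B) (t : R) : 'rV[R]_n.+1 :=
  \row_k lim (curve_diffquot gam i k t h
    @[h --> within [set h | 0 <= t + h <= 1] 0^']).

Definition C1_curve (R : realType) (n : nat) (X : topologicalType)
    (B : bmanifold R n X) (gam : R -> X) : Prop :=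
  {within `[0, 1], continuous gam} /\
  forall (i : chart B) (t : R) (k : 'I_n.+1), 0 <= t <= 1 -> dom B i (gam t) ->
    cvg (curve_diffquot gam i k t h
      @[h --> within [set h | 0 <= t + h <= 1] 0^']) /\
    velocity gam i u 0 k @[u --> within `[0, 1] (nbhs t)]
      --> velocity gam i t 0 k.

Definition is_speed (R : realType) (n : nat) (X : topologicalType)
    (g : riemannian R n X) (gam : R -> X) (v : R -> R) : Prop :=
  forall (i : chart g) (t : R), 0 <= t <= 1 -> dom g i (gam t) ->
    v t = Num.sqrt ((velocity gam i t *m met g i (phi g i (gam t))
                       *m (velocity gam i t)^T) 0 0).

Definition distance_to_bd (R : realType) (n : nat) (X : topologicalType)
    (g : riemannian R n X) (x : X) : \bar R :=
  ereal_inf [set l | exists (gam : R -> X) (v : R -> R),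
    [/\ C1_curve g gam, gam 0 = x, bd g (gam 1), is_speed g gam v &
        l = (\int[@lebesgue_measure R]_(t in `[0%R, 1%R]) (v t)%:E)%E]].

Definition rdist (R : realType) (n : nat) (X : topologicalType)
    (g : riemannian R n X) (x : X) : R :=
  fine (distance_to_bd g x).

(* From here on, functions on X are replaced by their local expressions in the
   chart i, that is, functions of p in the half-space. *)
Definition D (R : realType) (n : nat) (k : 'I_n.+1) (f : 'rV[R]_n.+1 -> R)
    (p : 'rV[R]_n.+1) : R :=
  pd (@halfspace R n) k f p.

Definition ginv (R : realType) (n : nat) (X : topologicalType)
    (g : riemannian R n X) (i : chart g) (p : 'rV[R]_n.+1) : 'M[R]_n.+1 :=
  invmx (met g i p).

Definition grad (R : realType) (n : nat) (X : topologicalType)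
    (g : riemannian R n X) (i : chart g) (f : 'rV[R]_n.+1 -> R)
    (a : 'I_n.+1) (p : 'rV[R]_n.+1) : R :=
  \sum_b ginv i p a b * D b f p.

Definition divergence (R : realType) (n : nat) (X : topologicalType)
    (g : riemannian R n X) (i : chart g)
    (V : 'I_n.+1 -> 'rV[R]_n.+1 -> R) (p : 'rV[R]_n.+1) : R :=
  (Num.sqrt (\det (met g i p)))^-1 *
  \sum_a D a (fun q => Num.sqrt (\det (met g i q)) * V a q) p.

Definition laplacian (R : realType) (n : nat) (X : topologicalType)
    (g : riemannian R n X) (i : chart g) (f : 'rV[R]_n.+1 -> R) :
    'rV[R]_n.+1 -> R :=
  divergence i (grad i f).

Definition nabla_grad (R : realType) (n : nat) (X : topologicalType)
    (g : riemannian R n X) (i : chart g) (f u : 'rV[R]_n.+1 -> R)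
    (p : 'rV[R]_n.+1) : R :=
  \sum_a grad i f a p * D a u p.

Definition christoffel (R : realType) (n : nat) (X : topologicalType)
    (g : riemannian R n X) (i : chart g) (c a b : 'I_n.+1)
    (p : 'rV[R]_n.+1) : R :=
  2^-1 * \sum_e ginv i p c e *
    (D a (fun q => met g i q b e) p + D b (fun q => met g i q a e) p
     - D e (fun q => met g i q a b) p).

(* Ric_(ab) = R^c_(acb); positive on round spheres *)
Definition ricci (R : realType) (n : nat) (X : topologicalType)
    (g : riemannian R n X) (i : chart g) (a b : 'I_n.+1)
    (p : 'rV[R]_n.+1) : R :=
  \sum_c (D c (christoffel i c a b) p - D b (christoffel i c a c) p
    + \sum_e (christoffel i c c e p * christoffel i e a b p
              - christoffel i c b e p * christoffel i e a c p)).

Definition scal (R : realType) (n : nat) (X : topologicalType)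
    (g : riemannian R n X) (i : chart g) (p : 'rV[R]_n.+1) : R :=
  \sum_a \sum_b ginv i p a b * ricci i a b p.

(* The parameter d replaces the number n in the definitions of J, rho, S and L;
   the objects of the singular Yamabe problem are those for d = n. *)

Definition J (R : realType) (n : nat) (X : topologicalType)
    (g : riemannian R n X) (i : chart g) (d : R) (p : 'rV[R]_n.+1) : R :=
  scal i p / (2 * d).

Definition rho (R : realType) (n : nat) (X : topologicalType)
    (g : riemannian R n X) (i : chart g) (d : R) (sg : 'rV[R]_n.+1 -> R)
    (p : 'rV[R]_n.+1) : R :=
  (- laplacian i sg p - sg p * J i d p) / (d + 1).

Definition Sop (R : realType) (n : nat) (X : topologicalType)
    (g : riemannian R n X) (i : chart g) (d : R) (sg : 'rV[R]_n.+1 -> R)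
    (p : 'rV[R]_n.+1) : R :=
  nabla_grad i sg sg p + 2 * sg p * rho i d sg p.

Definition Lop (R : realType) (n : nat) (X : topologicalType)
    (g : riemannian R n X) (i : chart g) (d : R) (sg : 'rV[R]_n.+1 -> R)
    (lam : R) (u : 'rV[R]_n.+1 -> R) (p : 'rV[R]_n.+1) : R :=
  (d + 2 * lam - 1) * (nabla_grad i sg u p + lam * rho i d sg p * u p)
  - sg p * (laplacian i u p + lam * J i d p * u p).

(* The leftmost factor of the composition (j = 0) has parameter
   (- d - N) / 2 + 1, the rightmost one (j = N - 2) has (- d + N) / 2 - 1. *)
Definition Qext (R : realType) (n : nat) (X : topologicalType)
    (g : riemannian R n X) (i : chart g) (N : nat) (d : R)
    (sg : 'rV[R]_n.+1 -> R) (p : 'rV[R]_n.+1) : R :=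
  - foldr (fun (j : nat) u => Lop i d sg ((- d - N%:R) / 2 + 1 + j%:R) u)
      (fun q => (N%:R - 1) * rho i d sg q - sg q * J i d q)
      (iota 0 N.-1) p.

(* Geodesic normal coordinates (r, x) near M: kap s x is the point with coordinates (s, x) and pi is the projection to M:
   kap is a diffeomorphism of [0, eps) x M onto the open neighbourhood V of M,
   given by the flow of the gradient field of r = rdist g. *)

Record geodesic_normal_coordinates (R : realType) (n : nat)
    (X : topologicalType) (g : riemannian R n X) (eps : R) (V : set X)
    (kap : R -> X -> X) (pi : X -> X) : Prop := GeodesicNormalCoordinates {
  gnc_eps : 0 < eps;
  gnc_open : open V;
  gnc_bd : bd g `<=` V;
  gnc_start : forall x, bd g x -> kap 0 x = x;
  gnc_into : forall x s, bd g x -> 0 <= s < eps ->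
    [/\ V (kap s x), rdist g (kap s x) = s & pi (kap s x) = x];
  gnc_onto : forall p, V p ->
    [/\ bd g (pi p), 0 <= rdist g p < eps & kap (rdist g p) (pi p) = p];
  gnc_diffeo : forall f : X -> R,
    Cinf_on g V f <-> Cinf_collar g eps (fun s x => f (kap s x));
  gnc_flow : forall (f : X -> R) (i : chart g) x s, Cinf_on g V f ->
    bd g x -> 0 <= s < eps -> dom g i (kap s x) ->
    h^-1 * (f (kap (s + h) x) - f (kap s x))
      @[h --> within [set h | 0 <= s + h] 0^']
    --> nabla_grad i (rdist g \o psi g i) (f \o psi g i) (phi g i (kap s x))
}.

(* r + c_2 r^2 + ... + c_K r^K with coefficients c_k \in C^oo(M) *)
Definition sigma_poly (R : realType) (n : nat) (X : topologicalType)
    (g : riemannian R n X) (pi : X -> X) (K : nat) (c : nat -> X -> R)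
    (p : X) : R :=
  rdist g p + \sum_(2 <= k < K.+1) c k (pi p) * rdist g p ^+ k.

(* S_d(g, sg) = 1 + r^K Rem on V *)
Definition S_expansion (R : realType) (n : nat) (X : topologicalType)
    (g : riemannian R n X) (V : set X) (d : R) (sg : X -> R) (K : nat)
    (Rem : X -> R) : Prop :=
  forall (i : chart g) p, V p -> dom g i p ->
    Sop i d (sg \o psi g i) (phi g i p) = 1 + rdist g p ^+ K * Rem p.

(* Bn is the singular Yamabe obstruction of M (only its values on M matter) *)
Definition is_obstruction (R : realType) (n : nat) (X : topologicalType)
    (g : riemannian R n X) (V : set X) (pi : X -> X) (Bn : X -> R) : Prop :=
  exists (c : nat -> X -> R) (Rem : X -> R),
    [/\ forall k, (2 <= k <= n.+1)%N -> Cinf_bd g (c k),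
        Cinf_on g V Rem,
        S_expansion g V n%:R (sigma_poly g pi n.+1 c) n.+1 Rem &
        forall x, bd g x -> Bn x = Rem x].

(* f is a rational function of d with values in C^oo(M): a polynomial in d with
   coefficients u_j \in C^oo(M), divided by a real polynomial q *)
Definition rational_Cinf_bd (R : realType) (n : nat) (X : topologicalType)
    (B : bmanifold R n X) (f : R -> X -> R) : Prop :=
  exists (q : {poly R}) (m : nat) (u : nat -> X -> R),
    [/\ q != 0,
        forall j, Cinf_bd B (u j) &
        forall d x, q.[d] != 0 -> bd B x ->
          f d x = (\sum_(j < m) u j x * d ^+ j) / q.[d]].

(* The solution of S_d(g, sg) = 1 + O(r^(N+1)) of the form
   r + c_2(d) r^2 + ... + c_(N+1)(d) r^(N+1) with coefficients rational in d. *)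
Definition formal_solution (R : realType) (n : nat) (X : topologicalType)
    (g : riemannian R n X) (V : set X) (pi : X -> X) (N : nat)
    (c : nat -> R -> X -> R) : Prop :=
  (forall k, (2 <= k <= N.+1)%N -> rational_Cinf_bd g (c k)) /\
  exists E : set R, finite_set E /\ forall d, ~ E d ->
    exists2 Rem : X -> R, Cinf_on g V Rem &
      S_expansion g V d (sigma_poly g pi N.+1 (fun k => c k d)) N.+1 Rem.

(* f coincides, outside a finite set, with a rational function whose principal
   part at a has coefficient c at (d - a)^-1 *)
Definition is_residue (R : realType) (f : R -> R) (a c : R) : Prop :=
  exists (m : nat) (b : nat -> R) (P Q : {poly R}) (E : set R),
    [/\ Q.[a] != 0, finite_set E &
        forall d, ~ E d ->
          f d = c / (d - a) + \sum_(2 <= j < m) b j / (d - a) ^+ j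
                + P.[d] / Q.[d]].

(* Main.v *)
Require Import Defs.
From HB Require Import structures.
From mathcomp Require Import all_boot all_order all_algebra.
From mathcomp Require Import all_classical all_reals all_analysis.
From mathcomp Require Import ring lra.

Set Implicit Arguments.
Unset Strict Implicit.
Unset Printing Implicit Defensive.

Import Order.TTheory GRing.Theory Num.Theory.
Import numFieldNormedType.Exports.

Local Open Scope classical_set_scope.
Local Open Scope ring_scope.

(** The coefficient c_k of r^k enters S_d(g, sigma) first at order r^(k-1), linearly
    and with the factor 2 k (d + 2 - k) / (d + 1) ([Sop_perturb]).  For k <= n + 1 this
    factor is invertible at d = n; hence c_2, ..., c_(n+1) are regular at d = n, and
    there they take the values of the expansion that defines the obstruction.  For
    k = n + 2 the factor has a simple zero at d = n, while the term of order r^(n+1) that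
    c_(n+2) has to cancel becomes the obstruction B at d = n.  So c_(n+2) has a simple
    pole at d = n, with residue - (n+1) B / (2 (n+2)) ([eta_recursion], [eta_regular],
    [eta_top]).

    In the formula for Q, c_(n+2) occurs first in rho, as
    - (n+2) (n+1) c_(n+2) r^n / (d+1).  Each of the n operators L lowers the order of
    vanishing on M by one and multiplies the leading coefficient by an explicit
    number ([Lop_expM]); every other occurrence of c_(n+2) comes with so many powers
    of r that it disappears on M ([Lop_step]).  The product of the numbers is
    (-1)^n n! n! ([Q_iterate]), and multiplying out gives the residue
    ([Q_principal_part]).

    The computation is made in an arbitrary chart at the boundary.  It uses the
    geodesic coordinates only through three facts: r is smooth near M, |dr| = 1
    there, and functions on M pull back to smooth functions ([Cinf_on_rdist],
    [gam_rdist], [Cinf_on_pi]).  Together with the product rules for grad and Delta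
    ([gamMr], [lapM]) these determine the leading terms.  Coefficients of powers of r
    are extracted by differentiating along grad r and restricting to M
    ([radial_top], [radial_low]), so that smooth functions never have to be divided
    by r.

    The dependence on d is handled in the ring of smooth functions tensored with
    rational functions of d ([dfam]), which is stable under differential operators;
    allowing only denominators that do not vanish at d = n gives the subring of
    regular families.  The recursion determines the coefficients of sigma at each
    point of M separately; that a pointwise regular family is a regular family
    ([bdfam_regular]) is what permits to differentiate them again. *)

(** * Smooth functions up to the boundary *)

(** S is relatively open in A, and at its points every coordinate direction can
    be followed inside A, so that the one-sided limits defining partial
    derivatives are unique. *)
Record reldom (R : realType) (m : nat) (A S : set 'rV[R]_m) : Prop := Reldom {
  reldom_sub : S `<=` A;
  reldom_nbhs : forall p, S p -> within A (nbhs p) S;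
  reldom_proper : forall k p, S p -> ProperFilter (within (stay A k p) 0^')
}.

Lemma eq_near_cvg (R : realType) (F : set_system R) {FF : Filter F} (f g : R -> R)
    (l : R) :
  (\forall h \near F, f h = g h) -> f h @[h --> F] --> l -> g h @[h --> F] --> l.
Proof.
by move=> fg; apply: cvg_trans; apply: near_eq_cvg; apply: filterS fg => h ->.
Qed.

Section Smooth.
Context (R : realType) (m : nat) (A S : set 'rV[R]_m) (dS : reldom A S).
Implicit Types (f g : 'rV[R]_m -> R) (p : 'rV[R]_m) (k : 'I_m) (l : R).

Definition has_pd f k p l :=
  diffquot k f p h @[h --> within (stay A k p) 0^'] --> l.

Lemma pdE f k p l : S p -> has_pd f k p l -> pd A k f p = l.
Proof. by move=> Sp fl; have := reldom_proper dS k Sp => pf; apply: cvg_lim. Qed.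

Lemma line_cvg k p : p + h *: delta_mx 0 k @[h --> within (stay A k p) 0^'] -->
   within A (nbhs p).
Proof.
move=> U; rewrite /within /= => UA.
have c : p + h *: delta_mx 0 k @[h --> (0:R)] --> p.
  rewrite -[p in _ --> p]addr0 -[X in _ --> p + X](scale0r (delta_mx 0 k : 'rV[R]_m)).
  by apply: cvgD; [exact: cvg_cst | apply: cvgZr_tmp; exact: cvg_id].
have /= c0 := c _ UA; rewrite nbhs_simpl in c0.
pose q h := p + h *: delta_mx 0 k.
have c1 : nbhs (0:R) (fun h => A (q h) -> U (q h)) by exact: c0.
rewrite nbhs_simpl; change (nbhs (0:R) (fun h => h != 0 -> stay A k p h -> U (q h))).
by apply: filterS c1 => h hU _ hA; exact: hU.
Qed.

Lemma line_dom k p : S p ->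
  \forall h \near within (stay A k p) 0^', S (p + h *: delta_mx 0 k).
Proof. by move=> Sp; apply: (line_cvg k); exact: (reldom_nbhs dS). Qed.

Lemma eq_has_pd f g k p l : S p -> (forall q, S q -> f q = g q) ->
  has_pd f k p l -> has_pd g k p l.
Proof.
move=> Sp fg; apply: eq_near_cvg.
apply: filterS (line_dom k Sp) => h Sh; rewrite /diffquot.
by rewrite !fg.
Qed.

Lemma eq_pd f g k p l : S p -> (forall q, S q -> f q = g q) ->
  has_pd f k p l -> pd A k g p = pd A k f p.
Proof.
by move=> Sp fg fl; rewrite (pdE Sp (eq_has_pd Sp fg fl)) (pdE Sp fl).
Qed.

(** Differentiability along a coordinate line gives continuity along that line,
    which is the continuity that the product, inverse and square root rules need. *)
Lemma has_pd_line f k p l : has_pd f k p l ->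
  f (p + h *: delta_mx 0 k) @[h --> within (stay A k p) 0^'] --> f p.
Proof.
move=> fl.
have h0 : h @[h --> within (stay A k p) (0:R)^'] --> (0:R).
  by apply: cvg_trans (cvg_within _) _; apply: nbhs_dnbhs.
have c : (h * diffquot k f p h + f p) @[h --> within (stay A k p) 0^'] --> 0 * l + f p.
  by apply: cvgD; [apply: cvgM|exact: cvg_cst].
rewrite mul0r add0r in c; apply: eq_near_cvg c.
have n0 : \forall h \near within (stay A k p) 0^', h != 0.
  by apply: (filterS _ (nbhs_dnbhs_neq (0:R))) => h h0' _.
apply: filterS n0 => h hN0; rewrite /diffquot /= mulVKf //.
by rewrite subrK.
Qed.

Lemma has_pd_cst c k p : has_pd (fun=> c) k p 0.
Proof.
apply: (@eq_near_cvg _ _ _ (fun=> 0)); last exact: cvg_cst.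
by apply: nearW => h; rewrite /diffquot subrr mulr0.
Qed.

Lemma has_pdD f g k p a b : has_pd f k p a -> has_pd g k p b ->
  has_pd (fun q => f q + g q) k p (a + b).
Proof.
move=> fa gb.
have c : (diffquot k f p h + diffquot k g p h)
    @[h --> within (stay A k p) 0^'] --> a + b by exact: cvgD.
apply: eq_near_cvg c; by apply: nearW => h; rewrite /diffquot /=; ring.
Qed.

Lemma has_pdM f g k p a b : has_pd f k p a -> has_pd g k p b ->
  has_pd (fun q => f q * g q) k p (a * g p + f p * b).
Proof.
move=> fa gb.
have c : (diffquot k f p h * g (p + h *: delta_mx 0 k) + f p * diffquot k g p h)
    @[h --> within (stay A k p) 0^'] --> a * g p + f p * b.
  apply: cvgD; first exact: cvgM fa (has_pd_line gb).
  by apply: cvgM gb; exact: cvg_cst.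
apply: eq_near_cvg c; by apply: nearW => h; rewrite /diffquot /=; ring.
Qed.

Lemma has_pdV f k p a : S p -> (forall q, S q -> f q != 0) -> has_pd f k p a ->
  has_pd (fun q => (f q)^-1) k p (- a * (f p * f p)^-1).
Proof.
move=> Sp f0 fa.
have fp0 : f p * f p != 0 by rewrite mulf_neq0 ?f0.
have c : (- diffquot k f p h * (f (p + h *: delta_mx 0 k) * f p)^-1)
    @[h --> within (stay A k p) 0^'] --> - a * (f p * f p)^-1.
  apply: cvgM; first exact: cvgN.
  by apply: cvgV => //; apply: cvgM; [exact: has_pd_line fa | exact: cvg_cst].
apply: eq_near_cvg c; apply: filterS (line_dom k Sp) => h Sh.
rewrite /diffquot; have := f0 _ Sh; have := f0 _ Sp => A0 B0.
set u := f (_ + _) in B0 *.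
have -> : u^-1 - (f p)^-1 = - (u - f p) / (u * f p) by field; rewrite A0 B0.
by ring.
Qed.

Lemma has_pd_sqrt f k p a : S p -> (forall q, S q -> 0 < f q) -> has_pd f k p a ->
  has_pd (fun q => Num.sqrt (f q)) k p (a * (Num.sqrt (f p) + Num.sqrt (f p))^-1).
Proof.
move=> Sp f0 fa.
have s0 q : S q -> 0 < Num.sqrt (f q) by move=> /f0; rewrite sqrtr_gt0.
have fp0 : Num.sqrt (f p) + Num.sqrt (f p) != 0 by rewrite gt_eqF// addr_gt0 ?s0.
have c : (diffquot k f p h *
    (Num.sqrt (f (p + h *: delta_mx 0 k)) + Num.sqrt (f p))^-1)
    @[h --> within (stay A k p) 0^']
    --> a * (Num.sqrt (f p) + Num.sqrt (f p))^-1.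
  apply: cvgM => //; apply: cvgV => //; apply: cvgD; last exact: cvg_cst.
  exact: cvg_comp (has_pd_line fa) (@sqrt_continuous R (f p)).
apply: eq_near_cvg c; apply: filterS (line_dom k Sp) => h Sh.
rewrite /diffquot; have := s0 _ Sh; have := s0 _ Sp => A0 B0.
set u := f (_ + _) in B0 *.
have e : u - f p = (Num.sqrt u - Num.sqrt (f p)) * (Num.sqrt u + Num.sqrt (f p)).
  have -> x y : (x - y) * (x + y) = x ^+ 2 - y ^+ 2 :> R by ring.
  by rewrite !sqr_sqrtr // ltW // ?f0.
by rewrite e -mulrA mulfK // gt_eqF // addr_gt0.
Qed.

(** The iterated derivatives in [Cinf] are applied with the head of the list
    outermost.  Inductions on the order of differentiation peel off the innermost
    derivative instead, which is what this recursion does. *)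
Fixpoint Cn (j : nat) f : Prop :=
  (forall p, S p -> f q @[q --> within A (nbhs p)] --> f p) /\
  if j is j'.+1 then
    (forall p k, S p -> has_pd f k p (pd A k f p)) /\ forall k, Cn j' (pd A k f)
  else True.

Lemma CnS j f : Cn j.+1 f -> Cn j f.
Proof.
elim: j f => [|j IH] f [cf [hf Cf]]; first by split.
by split => //; split => // k; apply: IH.
Qed.

Lemma Cn_cont j f p : Cn j f -> S p -> f q @[q --> within A (nbhs p)] --> f p.
Proof. by case: j => [|j] [cf _]; exact: cf. Qed.

Lemma eq_Cn j f g : (forall q, S q -> f q = g q) -> Cn j f -> Cn j g.
Proof.
elim: j f g => [|j IH] f g fg [cf Cf]; (split; first move=> p Sp).
- rewrite -fg //; apply: cvg_trans (cf p Sp); apply: near_eq_cvg.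
  by apply: filterS (reldom_nbhs dS Sp) => q Sq; rewrite fg.
- by [].
- rewrite -fg //; apply: cvg_trans (cf p Sp); apply: near_eq_cvg.
  by apply: filterS (reldom_nbhs dS Sp) => q Sq; rewrite fg.
case: Cf => hf Cf; split=> [p k Sp|k].
  by rewrite (eq_pd Sp fg (hf _ _ Sp)); exact: eq_has_pd (hf _ _ Sp).
by apply: IH (Cf k) => q Sq; rewrite (eq_pd Sq fg (hf _ _ Sq)).
Qed.

Lemma Cinf_Cn f : Cinf A S f <-> forall j, Cn j f.
Proof.
split=> [Cf j|Cf s].
  suff : forall s, Cn j (foldr (pd A) f s) by move=> /(_ [::]).
  elim: j => [|j IH] s; split=> //; try by move=> p Sp; case: (Cf s p Sp).
  split=> [p k Sp|k]; last exact: (IH (k :: s)).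
  by have [_ /(_ k)] := Cf s p Sp; rewrite /has_pd /pd.
suff : forall j, Cn j (foldr (pd A) f s).
  move=> C p Sp; split; first exact: Cn_cont (C 0%N) _.
  move=> k; apply/cvg_ex; exists (pd A k (foldr (pd A) f s) p).
  by case: (C 1%N) => _ [h _]; exact: h.
elim: s => [|k s IH] j //=; by case: (IH j.+1) => _ [_ h]; exact: h.
Qed.

Lemma Cn_cst j c : Cn j (fun=> c).
Proof.
elim: j c => [|j IH] c; split=> //; try by move=> p Sp; exact: cvg_cst.
split=> [p k Sp|k]; first by rewrite (pdE Sp (has_pd_cst c k p)); exact: has_pd_cst.
by apply: eq_Cn (IH 0) => q Sq; rewrite (pdE Sq (has_pd_cst c k q)).
Qed.

Lemma CnD j f g : Cn j f -> Cn j g -> Cn j (fun q => f q + g q).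
Proof.
elim: j f g => [|j IH] f g [cf Cf] [cg Cg]; split=> //;
  try by move=> p Sp; apply: cvgD; [exact: cf|exact: cg].
case: Cf Cg => hf Cf [hg Cg].
have h p k (Sp : S p) := has_pdD (hf p k Sp) (hg p k Sp).
split=> [p k Sp|k]; first by rewrite (pdE Sp (h _ _ Sp)); exact: h.
by apply: eq_Cn (IH _ _ (Cf k) (Cg k)) => q Sq; rewrite (pdE Sq (h _ _ Sq)).
Qed.

Lemma CnM j f g : Cn j f -> Cn j g -> Cn j (fun q => f q * g q).
Proof.
elim: j f g => [|j IH] f g Hf Hg; (split;
  first by move=> p Sp; apply: cvgM; [exact: Cn_cont Hf Sp|exact: Cn_cont Hg Sp]) => //.
have [Hf' Hg'] := (CnS Hf, CnS Hg); case: Hf Hg => cf [hf Cf] [cg [hg Cg]].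
have h p k (Sp : S p) := has_pdM (hf p k Sp) (hg p k Sp).
split=> [p k Sp|k]; first by rewrite (pdE Sp (h _ _ Sp)); exact: h.
apply: eq_Cn (CnD (IH _ _ (Cf k) Hg') (IH _ _ Hf' (Cg k))) => q Sq.
by rewrite (pdE Sq (h _ _ Sq)).
Qed.

Lemma CnV j f : (forall q, S q -> f q != 0) -> Cn j f -> Cn j (fun q => (f q)^-1).
Proof.
move=> f0; elim: j => [|j IH] Hf; (split;
  first by move=> p Sp; apply: cvgV; [exact: f0|exact: Cn_cont Hf Sp]) => //.
have Hf' := CnS Hf; case: Hf => cf [hf Cf].
have h p k (Sp : S p) := has_pdV Sp f0 (hf p k Sp).
split=> [p k Sp|k]; first by rewrite (pdE Sp (h _ _ Sp)); exact: h.
apply: eq_Cn (CnM (Cn_cst j (-1)) (CnM (Cf k) (CnM (IH Hf') (IH Hf')))) => q Sq.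
by rewrite (pdE Sq (h _ _ Sq)) invfM mulNr mul1r mulNr.
Qed.

Lemma Cn_sqrt j f : (forall q, S q -> 0 < f q) -> Cn j f ->
  Cn j (fun q => Num.sqrt (f q)).
Proof.
move=> f0; elim: j => [|j IH] Hf; (split; first by move=> p Sp;
  exact: cvg_comp (Cn_cont Hf Sp) (@sqrt_continuous R (f p))) => //.
have Hf' := CnS Hf; case: Hf => cf [hf Cf].
have h p k (Sp : S p) := has_pd_sqrt Sp f0 (hf p k Sp).
split=> [p k Sp|k]; first by rewrite (pdE Sp (h _ _ Sp)); exact: h.
have Hs := CnD (IH Hf') (IH Hf').
have s0 q : S q -> Num.sqrt (f q) + Num.sqrt (f q) != 0.
  by move=> /f0 ?; rewrite gt_eqF// addr_gt0 ?sqrtr_gt0.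
apply: eq_Cn (CnM (Cf k) (CnV s0 Hs)) => q Sq.
by rewrite (pdE Sq (h _ _ Sq)).
Qed.

Local Notation smooth := (Cinf A S).

Lemma eq_Cinf f g : (forall q, S q -> f q = g q) -> smooth f -> smooth g.
Proof. by move=> fg /Cinf_Cn Cf; apply/Cinf_Cn => j; exact: eq_Cn fg _. Qed.

Lemma Cinf_cst c : smooth (fun=> c).
Proof. by apply/Cinf_Cn => j; exact: Cn_cst. Qed.

Lemma CinfD f g : smooth f -> smooth g -> smooth (fun q => f q + g q).
Proof. by move=> /Cinf_Cn Cf /Cinf_Cn Cg; apply/Cinf_Cn => j; exact: CnD. Qed.

Lemma CinfM f g : smooth f -> smooth g -> smooth (fun q => f q * g q).
Proof. by move=> /Cinf_Cn Cf /Cinf_Cn Cg; apply/Cinf_Cn => j; exact: CnM. Qed.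

Lemma CinfV f : (forall q, S q -> f q != 0) -> smooth f -> smooth (fun q => (f q)^-1).
Proof. by move=> f0 /Cinf_Cn Cf; apply/Cinf_Cn => j; exact: CnV. Qed.

Lemma Cinf_sqrt f : (forall q, S q -> 0 < f q) -> smooth f ->
  smooth (fun q => Num.sqrt (f q)).
Proof. by move=> f0 /Cinf_Cn Cf; apply/Cinf_Cn => j; exact: Cn_sqrt. Qed.

Lemma CinfN f : smooth f -> smooth (fun q => - f q).
Proof.
by move=> Cf; apply: eq_Cinf (CinfM (Cinf_cst (-1)) Cf) => q _; rewrite mulN1r.
Qed.

Lemma CinfB f g : smooth f -> smooth g -> smooth (fun q => f q - g q).
Proof. by move=> Cf Cg; exact: CinfD Cf (CinfN Cg). Qed.

Lemma Cinf_sum (I : Type) (s : seq I) (P : pred I) (f : I -> 'rV[R]_m -> R) :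
  (forall i, P i -> smooth (f i)) -> smooth (fun q => \sum_(i <- s | P i) f i q).
Proof.
move=> Cf; elim: s => [|i s IH].
  by apply: eq_Cinf (Cinf_cst 0) => q _; rewrite big_nil.
have [Pi|nPi] := boolP (P i).
  by apply: eq_Cinf (CinfD (Cf i Pi) IH) => q _; rewrite big_cons Pi.
by apply: eq_Cinf IH => q _; rewrite big_cons (negbTE nPi).
Qed.

Lemma Cinf_prod (I : Type) (s : seq I) (P : pred I) (f : I -> 'rV[R]_m -> R) :
  (forall i, P i -> smooth (f i)) -> smooth (fun q => \prod_(i <- s | P i) f i q).
Proof.
move=> Cf; elim: s => [|i s IH].
  by apply: eq_Cinf (Cinf_cst 1) => q _; rewrite big_nil.
have [Pi|nPi] := boolP (P i).
  by apply: eq_Cinf (CinfM (Cf i Pi) IH) => q _; rewrite big_cons Pi.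
by apply: eq_Cinf IH => q _; rewrite big_cons (negbTE nPi).
Qed.

Lemma CinfX f j : smooth f -> smooth (fun q => f q ^+ j).
Proof.
move=> Cf; elim: j => [|j IH]; first by apply: eq_Cinf (Cinf_cst 1).
by apply: eq_Cinf (CinfM Cf IH) => q _; rewrite exprS.
Qed.

Lemma Cinf_pd f k : smooth f -> smooth (pd A k f).
Proof.
by move=> /Cinf_Cn Cf; apply/Cinf_Cn => j; case: (Cf j.+1) => _ [_ h]; exact: h.
Qed.

Lemma Cinf_has_pd f k p : smooth f -> S p -> has_pd f k p (pd A k f p).
Proof. by move=> /Cinf_Cn Cf Sp; case: (Cf 1%N) => _ [h _]; exact: h. Qed.

Lemma smooth_eq_pd f g k p : smooth f -> (forall q, S q -> f q = g q) -> S p ->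
  pd A k f p = pd A k g p.
Proof. by move=> Cf fg Sp; rewrite (eq_pd Sp fg (@Cinf_has_pd _ k p Cf Sp)). Qed.

Lemma pd_cst c k p : S p -> pd A k (fun=> c) p = 0.
Proof. by move=> Sp; rewrite (pdE Sp (has_pd_cst _ _ _)). Qed.

Lemma pdD f g k p : smooth f -> smooth g -> S p ->
  pd A k (fun q => f q + g q) p = pd A k f p + pd A k g p.
Proof.
move=> Cf Cg Sp.
by rewrite (pdE Sp (has_pdD (@Cinf_has_pd _ k p Cf Sp) (@Cinf_has_pd _ k p Cg Sp))).
Qed.

Lemma pdM f g k p : smooth f -> smooth g -> S p ->
  pd A k (fun q => f q * g q) p = pd A k f p * g p + f p * pd A k g p.
Proof.
move=> Cf Cg Sp.
by rewrite (pdE Sp (has_pdM (@Cinf_has_pd _ k p Cf Sp) (@Cinf_has_pd _ k p Cg Sp))).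
Qed.

Lemma Cinf_det j (M : 'rV[R]_m -> 'M[R]_j) :
  (forall a b, smooth (fun q => M q a b)) -> smooth (fun q => \det (M q)).
Proof.
move=> CM; apply: Cinf_sum => s _; apply: CinfM; first exact: Cinf_cst.
by apply: Cinf_prod => i _; exact: CM.
Qed.

Lemma Cinf_invmx j (M : 'rV[R]_m -> 'M[R]_j) :
  (forall q, S q -> \det (M q) != 0) ->
  (forall a b, smooth (fun q => M q a b)) ->
  forall a b, smooth (fun q => invmx (M q) a b).
Proof.
move=> M0 CM a b.
have Cc : smooth (fun q => cofactor (M q) b a).
  apply: CinfM; first exact: Cinf_cst.
  apply: Cinf_det => c d; apply: eq_Cinf (CM (lift b c) (lift a d)) => q _.
  by rewrite !mxE.
apply: eq_Cinf (CinfM (CinfV M0 (Cinf_det CM)) Cc) => q Sq.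
by rewrite /invmx unitmxE unitfE M0 // !mxE.
Qed.

End Smooth.

(** * The half-space and its boundary *)
Lemma within_setT (T : Type) (F : set_system T) {FF : Filter F} :
  within setT F = F.
Proof.
apply/seteqP; split=> U; rewrite /within /= => FU; last by apply: filterS FU.
by apply: filterS FU => x; exact.
Qed.

Lemma cvg_mx (R : realType) (T : Type) (F : set_system T) {FF : Filter F}
    (a b : nat) (f : T -> 'M[R]_(a, b)) (M : 'M[R]_(a, b)) :
  (forall i j, f x i j @[x --> F] --> M i j) -> f x @[x --> F] --> M.
Proof.
move=> fM U [P MP PU]; rewrite nbhs_simpl.
have Q : \forall x \near F, forall i j, P i j (f x i j).
  by apply: filter_forall => i; apply: filter_forall => j; exact: fM (MP i j).
by change (F (fun x => U (f x))); apply: filterS Q => x Q; exact: PU.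
Qed.

Section HalfSpace.
Context (R : realType) (n : nat).
Local Notation H := (@halfspace R n).

(** At a boundary point the transversal direction can only be followed inwards,
    which still leaves arbitrarily small increments. *)
Lemma reldom_half (S : set 'rV[R]_n.+1) : S `<=` H ->
  (forall p, S p -> within H (nbhs p) S) -> reldom H S.
Proof.
move=> SH Sn; split => // k p Sp; split; last exact: within_filter.
move=> e0; have {}e0 : \forall h \near (0:R), h != 0 -> ~ stay H k p h by exact: e0.
have e1 : \forall h \near (0:R)^'+, False.
  apply: (filterS _ e0) => h /= e h0; apply: (e (lt0r_neq0 h0)).
  rewrite /stay /halfspace /= !mxE addr_ge0 //; first exact: SH.
  by rewrite mulr_ge0 // ltW.
by have [] := filter_ex e1.
Qed.

Lemma reldom_open (S : set 'rV[R]_n) : open S -> reldom setT S.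
Proof.
move=> So; split => // [p Sp|k p Sp].
  have Sn : nbhs p S by exact: open_nbhs_nbhs.
  by rewrite within_setT.
rewrite (_ : stay setT k p = setT) // within_setT.
exact: Proper_dnbhs_numFieldType.
Qed.

Lemma tailvE (z : 'rV[R]_n.+1) j : tailv z 0 j = z 0 (lift ord0 j).
Proof. by rewrite /tailv mxE; congr (z _ _); apply/val_inj. Qed.

Lemma tailv_pt s (y : 'rV[R]_n) : tailv (pt s y) = y.
Proof. exact: row_mxKr. Qed.

Lemma pt0 s (y : 'rV[R]_n) : pt s y 0 0 = s.
Proof.
by rewrite /pt mxE; case: splitP => // j _; rewrite mxE (ord1 j) eqxx mulr1n.
Qed.

Lemma ptS s (y : 'rV[R]_n) j : pt s y 0 (lift ord0 j) = y 0 j.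
Proof. by rewrite -tailvE tailv_pt. Qed.

Lemma tailv_continuous : continuous (@tailv R n).
Proof.
move=> z; apply: (@cvg_mx _ _ (nbhs z) _) => i j; rewrite (ord1 i) tailvE.
rewrite (_ : (fun x => _) = (fun x : 'rV[R]_n.+1 => x 0 (lift ord0 j))).
  exact: coord_continuous.
by apply/funext => x; rewrite tailvE.
Qed.

Lemma pt_continuous s : continuous (@pt R n s).
Proof.
move=> y; apply: (@cvg_mx _ _ (nbhs y) _) => i k; rewrite (ord1 i).
have [j ->|->] := unliftP ord0 k.
  rewrite (_ : (fun x => _) = (fun x : 'rV[R]_n => x 0 j)).
    by rewrite ptS; exact: coord_continuous.
  by apply/funext => x; rewrite ptS.
rewrite (_ : (fun x => _) = (fun=> s)); first by rewrite pt0; exact: cvg_cst.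
by apply/funext => x; rewrite pt0.
Qed.

(** Turns smooth functions on M, seen in a chart of M, into smooth functions on
    the collar that are constant in the normal direction: the normal derivative is
    zero and the tangential ones are those of w. *)
Lemma Cinf_tailv (S : set 'rV[R]_n.+1) (T : set 'rV[R]_n) w :
  reldom H S -> reldom setT T -> (forall z, S z -> T (tailv z)) ->
  Cinf setT T w -> Cinf H S (fun z => w (tailv z)).
Proof.
move=> dS dT ST /Cinf_Cn Cw; apply/Cinf_Cn => j.
have cont (w' : 'rV[R]_n -> R) :
    (forall p, T p -> w' q @[q --> within setT (nbhs p)] --> w' p) ->
    forall z, S z -> w' (tailv q) @[q --> within H (nbhs z)] --> w' (tailv z).
  move=> cw z Sz; have {}cw : w' q @[q --> tailv z] --> w' (tailv z).
    by rewrite -[nbhs (tailv z)]within_setT; exact: cw (ST _ Sz).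
  by apply: cvg_within_filter; exact: cvg_comp (@tailv_continuous z) cw.
elim: j w {Cw}(Cw j) => [|j IH] w [cw Cw]; (split; first exact: cont) => //.
case: Cw => hw Cw.
have h0 z : has_pd H (fun z => w (tailv z)) ord0 z 0.
  apply: (@eq_near_cvg _ _ _ (fun=> 0)); last exact: cvg_cst.
  apply: nearW => h; rewrite /diffquot (_ : tailv (_ + _) = tailv z) ?subrr ?mulr0//.
  by apply/rowP => j'; rewrite !tailvE !mxE /= mulr0 addr0.
have hS z k : S z -> has_pd H (fun z => w (tailv z)) (lift ord0 k) z
   (pd setT k w (tailv z)).
  move=> Sz; have := hw _ k (ST _ Sz); rewrite /has_pd.
  have -> : diffquot (lift ord0 k) (fun z => w (tailv z)) z = diffquot k w (tailv z).
    apply/funext => h; rewrite /diffquot; congr (_ * (w _ - _)).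
    apply/rowP => j'; rewrite tailvE !mxE eqxx (inj_eq lift_inj) !andTb.
    by congr (z _ _ + _); exact/val_inj.
  rewrite (_ : stay setT _ _ = setT) ?within_setT // => hc.
  exact: cvg_within_filter.
split=> [z k Sz|k]; have [k' ->|->] := unliftP ord0 k.
- by rewrite (pdE dS Sz (hS _ _ Sz)); exact: hS.
- by rewrite (pdE dS Sz (h0 _)); exact: h0.
- by apply: (eq_Cn dS _ (IH _ (Cw k'))) => z Sz; rewrite (pdE dS Sz (hS _ _ Sz)).
by apply: (eq_Cn dS _ (Cn_cst dS j 0)) => z Sz; rewrite (pdE dS Sz (h0 _)).
Qed.
End HalfSpace.

(** * Gradient and Laplacian in a chart *)

(** All matrices on the segment from the identity to A are positive definite, hence
    nonsingular, so the determinant keeps the sign it has at the identity. *)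
Lemma posdef_det_gt0 (R : rcfType) (m : nat) (A : 'M[R]_m) :
  (forall v : 'rV[R]_m, v != 0 -> 0 < (v *m A *m v^T) 0 0) -> 0 < \det A.
Proof.
move=> Apos.
pose M : 'M[{poly R}]_m := \matrix_(i, j) ((A i j)%:P * 'X + (1%:M i j)%:P * (1 - 'X)).
have detM t : (\det M).[t] = \det (t *: A + (1 - t) *: 1%:M).
  rewrite -horner_evalE -det_map_mx; congr (\det _); apply/matrixP => a b.
  by rewrite !mxE /= horner_evalE !hornerE mulrC (mulrC (1 - t)).
have noroot t : 0 <= t <= 1 -> (\det M).[t] != 0.
  case/andP=> t0 t1; rewrite detM; apply/det0P => -[v v0 vM].
  suff : 0 < (v *m (t *: A + (1 - t) *: 1%:M) *m v^T) 0 0.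
    by rewrite vM mul0mx mxE ltxx.
  have vv : 0 < (v *m v^T) 0 0.
    rewrite mxE lt0r; apply/andP; split; last first.
      by apply: sumr_ge0 => j _; rewrite mxE -expr2 sqr_ge0.
    apply: contraNneq v0 => s0; apply/eqP/rowP => j; rewrite !mxE.
    have /eqP := s0; rewrite psumr_eq0 => [/allP/(_ j)|k _].
      by rewrite mem_index_enum mxE -expr2 sqrf_eq0 => /(_ isT)/eqP.
    by rewrite mxE -expr2 sqr_ge0.
  rewrite mulmxDr mulmxDl -!scalemxAr -!scalemxAl mulmx1 !mxE -/(_ 0 0).
  have := Apos v v0; rewrite [X in 0 < X]mxE; rewrite [X in 0 < X]mxE in vv => Av.
  move: t0; rewrite le_eqVlt => /predU1P[<-|t0]; first by rewrite mul0r subr0 mul1r add0r.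
  by apply: ltr_wpDr; rewrite ?mulr_gt0// mulr_ge0 // ?subr_ge0 // ltW.
have d1 : \det A = (\det M).[1] by rewrite detM scale1r subrr scale0r addr0.
have d0 : (\det M).[0] = 1 by rewrite detM scale0r subr0 scale1r add0r det1.
rewrite d1 ltNge; apply/negP => le0.
have [|t t01] := @poly_ivt R (- \det M) 0 1 ler01.
  by rewrite !hornerN d0 oppr_le0 ler01 oppr_ge0.
by rewrite rootN => /eqP; apply/eqP/noroot.
Qed.

Lemma sub_Cinf (R : realType) (m : nat) (A S T : set 'rV[R]_m) f :
  T `<=` S -> Cinf A S f -> Cinf A T f.
Proof. by move=> TS Cf s p Tp; exact: Cf (TS _ Tp). Qed.

Section ChartCalculus.
Context (R : realType) (n : nat) (X : topologicalType) (g : riemannian R n X)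
  (V : set X) (Vopen : open V) (i : chart g).
Local Notation H := (@halfspace R n).
Local Notation S := (phi g i @` (dom g i `&` V)).
Local Notation smooth := (Cinf H S).
Implicit Types (f u v : 'rV[R]_n.+1 -> R) (p q : 'rV[R]_n.+1).

(** The image of an open piece of X is cut out of the image of the chart by the
    continuous inverse of the chart. *)
Lemma chart_reldom : reldom H S.
Proof.
have [U [Uo Ueq]] := phi_img_open i.
have SU : S `<=` U `&` H.
  by rewrite -Ueq => _ [x [dx Vx] <-]; exists x.
apply: reldom_half => [p /SU[]//|p Sp].
have [x [dx Vx] xp] := Sp.
have Up : nbhs p U by apply: open_nbhs_nbhs; split => //; case: (SU _ Sp).
have Dp : (phi g i @` dom g i) p by exists x.
have psic : psi g i q @[q --> within (phi g i @` dom g i) (nbhs p)] --> psi g i p.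
  by have /subspace_continuousP/(_ p Dp) := @psi_continuous _ _ _ g i.
have psip : psi g i p = x by rewrite -xp phiK.
have Vx' : nbhs (psi g i p) V by rewrite psip; exact: open_nbhs_nbhs.
have Vp : \forall q \near p, (phi g i @` dom g i) q -> V (psi g i q).
  exact: psic Vx'.
have UV : \forall q \near p, U q /\ ((phi g i @` dom g i) q -> V (psi g i q)).
  by apply: filterI.
suff : \forall q \near p, H q -> S q by [].
apply: filterS UV => q [Uq Vq] Hq.
have Dq : (phi g i @` dom g i) q by rewrite Ueq.
case: (Dq) => y dy yq; exists y => //; split => //.
by rewrite -(phiK dy) yq; exact: Vq.
Qed.

Let dS := chart_reldom.

Lemma chartP p : S p -> exists x, [/\ dom g i x, V x, phi g i x = p & psi g i p = x].
Proof. by move=> [x [dx Vx] <-]; exists x; rewrite phiK. Qed.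

Lemma met_det_gt0 p : S p -> 0 < \det (met g i p).
Proof.
by case/chartP => x [dx _ <- _]; apply: posdef_det_gt0 => v; exact: met_pos.
Qed.

Lemma Cinf_met a b : smooth (fun q => met g i q a b).
Proof. by apply: sub_Cinf (@met_smooth _ _ _ g i a b) => p [x [dx _] <-]; exists x. Qed.

Lemma Cinf_ginv a b : smooth (fun q => ginv i q a b).
Proof.
apply: (Cinf_invmx dS) => [q Sq|c d]; last exact: Cinf_met.
by rewrite gt_eqF // met_det_gt0.
Qed.

Lemma ginv_sym a b p : S p -> ginv i p a b = ginv i p b a.
Proof.
case/chartP => x [dx _ <- _]; rewrite /ginv.
by rewrite -[in RHS](met_sym dx) -trmx_inv mxE.
Qed.

Local Notation voldens := (fun q => Num.sqrt (\det (met g i q))).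

Lemma Cinf_voldens : smooth voldens.
Proof. by apply: (Cinf_sqrt dS) met_det_gt0 (Cinf_det dS Cinf_met). Qed.

Lemma voldens_neq0 p : S p -> voldens p != 0.
Proof. by move=> Sp; rewrite gt_eqF // sqrtr_gt0 met_det_gt0. Qed.

Lemma Cinf_D f a : smooth f -> smooth (D a f).
Proof. exact: Cinf_pd. Qed.

Lemma Cinf_grad f a : smooth f -> smooth (grad i f a).
Proof.
move=> Cf; apply: (Cinf_sum dS) => b _.
by apply: (CinfM dS); [exact: Cinf_ginv | exact: Cinf_D].
Qed.

Local Notation gam := (nabla_grad i).
Local Notation lap := (laplacian i).

Lemma Cinf_gam f u : smooth f -> smooth u -> smooth (gam f u).
Proof.
move=> Cf Cu; apply: (Cinf_sum dS) => b _.
by apply: (CinfM dS); [exact: Cinf_grad | exact: Cinf_D].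
Qed.

Lemma Cinf_lap f : smooth f -> smooth (lap f).
Proof.
move=> Cf; apply: (CinfM dS); first exact: (CinfV dS voldens_neq0 Cinf_voldens).
apply: (Cinf_sum dS) => b _; apply: Cinf_D.
by apply: (CinfM dS); [exact: Cinf_voldens | exact: Cinf_grad].
Qed.

Lemma Cinf_scal : smooth (scal i).
Proof.
have CC c a b : smooth (christoffel i c a b).
  apply: (CinfM dS); first exact: (Cinf_cst dS).
  apply: (Cinf_sum dS) => e _; apply: (CinfM dS); first exact: Cinf_ginv.
  by apply: (CinfB dS); [apply: (CinfD dS)|]; apply: Cinf_D; exact: Cinf_met.
apply: (Cinf_sum dS) => a _; apply: (Cinf_sum dS) => b _.
apply: (CinfM dS); first exact: Cinf_ginv.
apply: (Cinf_sum dS) => c _; apply: (CinfD dS).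
  by apply: (CinfB dS); apply: Cinf_D; exact: CC.
by apply: (Cinf_sum dS) => e _; apply: (CinfB dS); apply: (CinfM dS); exact: CC.
Qed.

(** Symmetry of the metric; it turns derivation rules in the second argument into
    rules for both arguments. *)
Lemma gamC f u p : S p -> gam f u p = gam u f p.
Proof.
move=> Sp; rewrite /nabla_grad /grad.
under eq_bigr do rewrite mulr_suml.
rewrite exchange_big /=; apply: eq_bigr => b _; rewrite mulr_suml.
by apply: eq_bigr => a _; rewrite (ginv_sym _ _ Sp); ring.
Qed.

Lemma eq_D f u a p : smooth f -> (forall q, S q -> f q = u q) -> S p ->
  D a f p = D a u p.
Proof. by move=> Cf fu Sp; exact: (smooth_eq_pd dS). Qed.

Lemma eq_grad f u a p : smooth f -> (forall q, S q -> f q = u q) -> S p ->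
  grad i f a p = grad i u a p.
Proof.
by move=> Cf fu Sp; apply: eq_bigr => b _; rewrite (eq_D _ Cf fu Sp).
Qed.

Lemma eq_gam f u v p : smooth u -> (forall q, S q -> u q = v q) -> S p ->
  gam f u p = gam f v p.
Proof.
by move=> Cf fu Sp; apply: eq_bigr => b _; rewrite (eq_D _ Cf fu Sp).
Qed.

Lemma eq_lap f u p : smooth f -> (forall q, S q -> f q = u q) -> S p ->
  lap f p = lap u p.
Proof.
move=> Cf fu Sp; congr (_ * _); apply: eq_bigr => b _; apply: eq_D Sp.
  by apply: (CinfM dS); [exact: Cinf_voldens | exact: Cinf_grad].
by move=> q Sq; rewrite (eq_grad _ Cf fu Sq).
Qed.

Lemma gam_cst f c p : S p -> gam f (fun=> c) p = 0.
Proof.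
by move=> Sp; rewrite /nabla_grad big1 // => a _; rewrite /D (pd_cst dS) ?mulr0.
Qed.

Lemma gamDr f u v p : smooth u -> smooth v -> S p ->
  gam f (fun q => u q + v q) p = gam f u p + gam f v p.
Proof.
move=> Cu Cv Sp; rewrite /nabla_grad -big_split; apply: eq_bigr => a _ /=.
by rewrite /D (pdD dS) // mulrDr.
Qed.

Lemma gamMr f u v p : smooth u -> smooth v -> S p ->
  gam f (fun q => u q * v q) p = u p * gam f v p + v p * gam f u p.
Proof.
move=> Cu Cv Sp; rewrite /nabla_grad !mulr_sumr -big_split; apply: eq_bigr => a _ /=.
by rewrite /D (pdM dS) //; ring.
Qed.

Lemma gradD f u a p : smooth f -> smooth u -> S p ->
  grad i (fun q => f q + u q) a p = grad i f a p + grad i u a p.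
Proof.
move=> Cf Cu Sp; rewrite /grad -big_split; apply: eq_bigr => b _ /=.
by rewrite /D (pdD dS) // mulrDr.
Qed.

Lemma gradM f u a p : smooth f -> smooth u -> S p ->
  grad i (fun q => f q * u q) a p = f p * grad i u a p + u p * grad i f a p.
Proof.
move=> Cf Cu Sp; rewrite /grad !mulr_sumr -big_split; apply: eq_bigr => b _ /=.
by rewrite /D (pdM dS) //; ring.
Qed.

Let Cvg f a : smooth f -> smooth (fun q => voldens q * grad i f a q).
Proof. by move=> Cf; apply: (CinfM dS); [exact: Cinf_voldens | exact: Cinf_grad]. Qed.

Lemma lapD f u p : smooth f -> smooth u -> S p ->
  lap (fun q => f q + u q) p = lap f p + lap u p.
Proof.
move=> Cf Cu Sp; rewrite /laplacian /divergence -mulrDr -big_split /=; congr (_ * _).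
apply: eq_bigr => a _; rewrite /D -(pdD dS) //; try exact: Cvg.
apply: eq_D Sp; first exact: Cvg (CinfD dS Cf Cu).
by move=> q Sq; rewrite gradD // mulrDr.
Qed.

(** Both mixed terms of div (f grad u + u grad f) equal <grad f, grad u>, by the
    symmetry of the metric. *)
Lemma lapM f u p : smooth f -> smooth u -> S p ->
  lap (fun q => f q * u q) p = f p * lap u p + u p * lap f p + 2 * gam f u p.
Proof.
move=> Cf Cu Sp.
have -> : 2 * gam f u p = gam f u p + gam u f p by rewrite (gamC u f Sp); ring.
rewrite /laplacian /divergence /nabla_grad.
transitivity ((voldens p)^-1 * (\sum_a (f p * D a (fun q => voldens q * grad i u a q) p
   + u p * D a (fun q => voldens q * grad i f a q) p
   + voldens p * (grad i f a p * D a u p + grad i u a p * D a f p)))); last first.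
  rewrite !big_split /= -!mulr_sumr big_split /=.
  by field; exact: voldens_neq0.
congr (_ * _); apply: eq_bigr => a _.
have -> : D a (fun q => voldens q * grad i (fun q0 => f q0 * u q0) a q) p =
  D a (fun q => f q * (voldens q * grad i u a q) + u q * (voldens q * grad i f a q)) p.
  apply: eq_D Sp; first exact: Cvg (CinfM dS Cf Cu).
  by move=> q Sq; rewrite gradM //; ring.
rewrite /D (pdD dS a (CinfM dS Cf (Cvg a Cu)) (CinfM dS Cu (Cvg a Cf)) Sp).
by rewrite (pdM dS a Cf (Cvg a Cu) Sp) (pdM dS a Cu (Cvg a Cf) Sp); ring.
Qed.

Lemma lap_cst c p : S p -> lap (fun=> c) p = 0.
Proof.
move=> Sp; rewrite /laplacian /divergence big1 ?mulr0 // => a _.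
rewrite -(pd_cst dS 0 a Sp); symmetry; apply: eq_D Sp; first exact: (Cinf_cst dS).
move=> q Sq; rewrite /grad big1 ?mulr0 // => b _.
by rewrite /D (pd_cst dS) ?mulr0.
Qed.

End ChartCalculus.

(** * Geodesic normal coordinates *)
Section Collar.
Context (R : realType) (n : nat) (X : topologicalType) (g : riemannian R n X)
  (eps : R) (V : set X) (kap : R -> X -> X) (pi : X -> X).
Hypothesis coords : geodesic_normal_coordinates g eps V kap pi.
Local Notation H := (@halfspace R n).
Local Notation S i := (phi g i @` (dom g i `&` V)).
Local Notation bdset i := [set y : 'rV[R]_n | (phi g i @` dom g i) (pt 0 y)].
Local Notation collar i :=
  [set z : 'rV[R]_n.+1 | 0 <= z 0 0 < eps /\ (phi g i @` dom g i) (pt 0 (tailv z))].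

Lemma rdist_bd x : bd g x -> rdist g x = 0.
Proof.
move=> bx; have := gnc_into coords bx (s := 0).
by rewrite lexx (gnc_eps coords) => /(_ isT)[_]; rewrite (gnc_start coords bx).
Qed.

Lemma pi_bd x : bd g x -> pi x = x.
Proof.
move=> bx; have := gnc_into coords bx (s := 0).
by rewrite lexx (gnc_eps coords) => /(_ isT)[_ _]; rewrite (gnc_start coords bx).
Qed.

Lemma bd_psi (i : chart g) y : bdset i y -> bd g (psi g i (pt 0 y)).
Proof. by move=> [x dx xy]; exists i; rewrite -xy phiK // xy pt0. Qed.

Lemma bdset_open (i : chart g) : open (bdset i).
Proof.
have [U [Uo Ueq]] := phi_img_open i.
have -> : bdset i = @pt R n 0 @^-1` U.
  have E y : bdset i y = (U `&` H) (pt 0 y) by rewrite -Ueq.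
  apply/seteqP; split=> y; rewrite E; first by case.
  by split => //; rewrite /halfspace /= pt0.
by apply: open_comp => // y _; exact: pt_continuous.
Qed.

Lemma collar_reldom (i : chart g) : reldom H (collar i).
Proof.
apply: reldom_half => [z [/andP[]]//|z [/andP[z0 zeps] zb]].
have U1 : \forall q \near z, (q : 'rV[R]_n.+1) 0 0 < eps.
  have c : (q : 'rV[R]_n.+1) 0 0 @[q --> z] --> z 0 0 by exact: coord_continuous.
  have o : nbhs (z 0 0) [set t : R | t < eps].
    by apply: open_nbhs_nbhs; split => //; exact: open_lt.
  exact: c _ o.
have U2 : \forall q \near z, bdset i (tailv q).
  apply: (@tailv_continuous R n z); apply: open_nbhs_nbhs; split => //.
  exact: bdset_open.
suff : \forall q \near z, H q -> collar i q by [].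
have U12 : \forall q \near z, (q : 'rV[R]_n.+1) 0 0 < eps /\ bdset i (tailv q).
  exact: filterI.
by apply: filterS U12 => q [q0 qb] Hq; split => //; apply/andP.
Qed.

Lemma Cinf_coord0 (T : set 'rV[R]_n.+1) : reldom H T -> Cinf H T (fun z => z 0 0).
Proof.
move=> dT; have h k z : has_pd H (fun z : 'rV[R]_n.+1 => z 0 0) k z (0 == k)%:R.
  have n0 : \forall h \near within (stay H k z) 0^', h != 0.
    by apply: (filterS _ (nbhs_dnbhs_neq (0:R))) => h h0' _.
  apply: (@eq_near_cvg _ _ _ (fun=> (0 == k)%:R)); last exact: cvg_cst.
  apply: filterS n0 => h h0; rewrite /diffquot !mxE eqxx andTb.
  by rewrite addrAC subrr add0r mulKf.
apply/Cinf_Cn => j; case: j => [|j]; (split;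
  first by move=> p _; apply: cvg_within_filter; exact: coord_continuous) => //.
split=> [z k Tz|k]; first by rewrite (pdE dT Tz (h _ _)); exact: h.
by apply: (eq_Cn dT _ (Cn_cst dT j (0 == k)%:R)) => z Tz; rewrite (pdE dT Tz (h _ _)).
Qed.

(** In the coordinates of the collar, r is the first coordinate function. *)
Lemma Cinf_on_rdist : Cinf_on g V (rdist g).
Proof.
apply/(gnc_diffeo coords) => i.
apply: (eq_Cinf (collar_reldom i) _ (Cinf_coord0 (collar_reldom i))) => z [z0 zb].
by have [_ ->] := gnc_into coords (bd_psi zb) z0.
Qed.

(** In the coordinates of the collar, u o pi does not depend on r. *)
Lemma Cinf_on_pi u : Cinf_bd g u -> Cinf_on g V (u \o pi).
Proof.
move=> Cu; apply/(gnc_diffeo coords) => i.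
have T z : collar i z -> bdset i (tailv z) by case.
have := Cinf_tailv (collar_reldom i) (reldom_open (@bdset_open i)) T (Cu i).
apply: (eq_Cinf (collar_reldom i)) => z [z0 zb] /=.
by have [_ _ ->] := gnc_into coords (bd_psi zb) z0.
Qed.

(** The curves s |-> kap s y are the flow lines of grad r and r has value s at kap s y,
    so the derivative of r along grad r is 1. *)
Lemma gam_rdist (i : chart g) p : S i p ->
  nabla_grad i (rdist g \o psi g i) (rdist g \o psi g i) p = 1.
Proof.
case=> x [dx Vx] xp; have [bx s_eps kx] := gnc_onto coords Vx.
set s := rdist g x in s_eps kx; set y := pi x in bx kx.
have dk : dom g i (kap s y) by rewrite kx.
have := gnc_flow coords Cinf_on_rdist bx s_eps dk.
rewrite kx xp => c1.
case/andP: (s_eps) => s0 se.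
have heps : \forall h \near within [set h | 0 <= s + h] (0 : R)^', s + h < eps.
  have : \forall h \near (0:R), h < eps - s.
    by apply: open_nbhs_nbhs; split; [exact: open_lt | rewrite /= subr_gt0].
  by apply: filterS => h hs _ _; rewrite addrC -ltrBrDr.
have n0 : \forall h \near within [set h | 0 <= s + h] (0 : R)^', h != 0.
  by apply: (filterS _ (nbhs_dnbhs_neq (0:R))) => h h0' _.
have hin : \forall h \near within [set h | 0 <= s + h] (0 : R)^', 0 <= s + h.
  by apply: withinT.
have c2 : h^-1 * (rdist g (kap (s + h) y) - rdist g x)
      @[h --> within [set h | 0 <= s + h] 0^'] --> (1 : R).
  apply: (@eq_near_cvg _ _ _ (fun=> 1)); last exact: cvg_cst.
  near=> h.
  have h0 : h != 0 by near: h.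
  have sh : 0 <= s + h < eps by apply/andP; split; near: h.
  have [_ -> _] := gnc_into coords bx sh.
  by rewrite -/s addrAC subrr add0r mulVf.
have pf : ProperFilter (within [set h | 0 <= s + h] (0 : R)^').
  split; last exact: within_filter.
  move=> e0; have {}e0 : \forall h \near (0:R), h != 0 -> ~ (0 <= s + h) by exact: e0.
  have e1 : \forall h \near (0:R)^'+, False.
    apply: (filterS _ e0) => h /= e h0; apply: (e (lt0r_neq0 h0)).
    by rewrite addr_ge0 // ltW.
  by have [] := filter_ex e1.
exact: (cvg_unique _ c1 c2).
Unshelve. all: by end_near.
Qed.

End Collar.

(** * Rational functions of the dimension parameter *)

(** Rational functions of d are compared away from finitely many values of d: poles
    and the exceptional values for which the equation for sigma is not assumed. *)
Definition cofin (R : Type) : set_system R := [set A | finite_set (~` A)].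

#[global] Instance cofin_filter (R : Type) : Filter (@cofin R).
Proof.
split; rewrite /cofin.
- by rewrite /= setCT.
- move=> A B fA fB; suff : finite_set (~` (A `&` B)) by [].
  by rewrite setCI finite_setU.
- by move=> A B AB; apply: sub_finite_set; exact: subsetC.
Qed.

#[global] Instance cofin_proper (R : realType) : ProperFilter (@cofin R).
Proof.
split; last exact: cofin_filter.
rewrite /cofin /= setC0 => /finite_seqP[s sE].
have : [set` s] (1 + \sum_(x <- s) `|x|) by rewrite -sE.
move=> /= s1; suff : 1 + \sum_(x <- s) `|x| <= \sum_(x <- s) `|x|.
  by rewrite gerDr ler10.
rewrite [leRHS](big_rem _ s1) /= ger0_norm ?addr_ge0 ?sumr_ge0//.
by rewrite lerDl sumr_ge0.
Qed.

Section Rational.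
Context (R : realType).
Implicit Types (P Q : {poly R}) (f h : R -> R).

Lemma cofin_neq0 P : P != 0 -> \forall d \near @cofin R, P.[d] != 0.
Proof.
move=> P0; suff fin m : forall P, (size P <= m)%N -> P != 0 ->
    finite_set [set d | P.[d] = 0].
  rewrite /cofin /prop_near1 /nbhs /=; apply: sub_finite_set (fin _ _ (leqnn _) P0).
  by move=> d /= /negP; rewrite negbK => /eqP.
elim: m => [|m IH] {P0}P sP P0; first by rewrite leqn0 size_poly_eq0 (negbTE P0) in sP.
have [[d /eqP Pd]|nroot] := pselect (exists d, P.[d] = 0); last first.
  rewrite (_ : [set d | _] = set0) //.
  by apply/seteqP; split=> d // Pd; case: nroot; exists d.
have /factor_theorem[Q PQ] := Pd.
have Q0 : Q != 0 by apply: contraNneq P0 => Q0; rewrite PQ Q0 mul0r.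
have sQ : (size Q <= m)%N.
  by move: sP; rewrite PQ size_Mmonic ?monicXsubC // size_XsubC addn2.
apply: sub_finite_set (_ : finite_set ([set d] `|` [set x | Q.[x] = 0])); last first.
  by rewrite finite_setU; split; [exact: finite_set1 | exact: IH].
move=> x /= /eqP; rewrite PQ hornerM mulf_eq0 => /orP[/eqP|]; first by right.
by rewrite hornerXsubC subr_eq0 => /eqP; left.
Qed.

Lemma cofin_eq0 P : (\forall d \near @cofin R, P.[d] = 0) -> P = 0.
Proof.
move=> P0; apply/eqP/negP => /negP /cofin_neq0 Pn.
by have [d [-> /eqP]] := filter_ex (filterI P0 Pn).
Qed.

Lemma cofin_neq (a : R) : \forall d \near @cofin R, d - a != 0.
Proof.
have Xa : 'X - a%:P != 0 :> {poly R} by exact: monic_neq0 (monicXsubC a).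
by apply: filterS (cofin_neq0 Xa) => d; rewrite hornerXsubC.
Qed.

(** U is the set of admissible denominators: the nonzero polynomials for all
    rational functions, those not vanishing at a for the functions regular at a. *)
Definition ratfun (U : {poly R} -> Prop) f :=
  exists P Q, U Q /\ \forall d \near @cofin R, f d = P.[d] / Q.[d].

Record denominators (U : {poly R} -> Prop) : Prop := Denominators {
  den1 : U 1;
  denM : forall P Q, U P -> U Q -> U (P * Q);
  den_neq0 : forall P, U P -> P != 0
}.

Section Closure.
Context (U : {poly R} -> Prop) (denU : denominators U).
Local Notation K := (ratfun U).

Lemma ratfun_eq f h : (\forall d \near @cofin R, f d = h d) -> K f -> K h.
Proof.
move=> fh [P [Q [UQ fE]]]; exists P, Q; split=> //.
by apply: filterS2 fh fE => d <-.
Qed.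

Lemma ratfun_poly P : K (fun d => P.[d]).
Proof.
exists P, 1; split; first exact: den1.
by apply: nearW => d; rewrite hornerC divr1.
Qed.

Lemma ratfun_cst c : K (fun=> c).
Proof. by apply: ratfun_eq (ratfun_poly c%:P); apply: nearW => d; rewrite hornerC. Qed.

Lemma ratfun_id : K (fun d => d).
Proof. by apply: ratfun_eq (ratfun_poly 'X); apply: nearW => d; rewrite hornerX. Qed.

Lemma ratfunD f h : K f -> K h -> K (fun d => f d + h d).
Proof.
move=> [P [Q [UQ fE]]] [P' [Q' [UQ' hE]]].
exists (P * Q' + P' * Q), (Q * Q'); split; first exact: denM.
have [Q0 Q0'] := (cofin_neq0 (den_neq0 denU UQ), cofin_neq0 (den_neq0 denU UQ')).
near=> d; rewrite !hornerE.
have -> : f d = P.[d] / Q.[d] by near: d.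
have -> : h d = P'.[d] / Q'.[d] by near: d.
by field; apply/andP; split; near: d.
Unshelve. all: by end_near.
Qed.

Lemma ratfunM f h : K f -> K h -> K (fun d => f d * h d).
Proof.
move=> [P [Q [UQ fE]]] [P' [Q' [UQ' hE]]].
exists (P * P'), (Q * Q'); split; first exact: denM.
by apply: filterS2 fE hE => d -> ->; rewrite hornerM hornerM invfM; ring.
Qed.

Lemma ratfunV Q : U Q -> K (fun d => Q.[d]^-1).
Proof.
by move=> UQ; exists 1, Q; split=> //; apply: nearW => d; rewrite hornerC mul1r.
Qed.

End Closure.

Definition nonzero : {poly R} -> Prop := fun Q => Q != 0.
Definition nonvanishing (a : R) : {poly R} -> Prop := fun Q => Q.[a] != 0.

Lemma den_nonzero : denominators nonzero.
Proof. by split=> [|P Q|P] //; [exact: oner_neq0 | exact: mulf_neq0]. Qed.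

Lemma den_nonvanishing a : denominators (nonvanishing a).
Proof.
split=> [|P Q|P]; rewrite /nonvanishing.
- by rewrite hornerC oner_neq0.
- by rewrite hornerM; exact: mulf_neq0.
by apply: contraNneq => ->; rewrite horner0.
Qed.

Lemma regular_ratfun a f : ratfun (nonvanishing a) f -> ratfun nonzero f.
Proof.
move=> [P [Q [Qa fE]]]; exists P, Q; split=> //.
exact: (den_neq0 (den_nonvanishing a)).
Qed.

(** First-order Taylor expansion at a: P Q(a) - P(a) Q vanishes at a. *)
Lemma regular_split a f : ratfun (nonvanishing a) f ->
  exists c h, ratfun (nonvanishing a) h /\
    \forall d \near @cofin R, f d = c + (d - a) * h d.
Proof.
move=> [P [Q [Qa fE]]].
have : root (P * Q.[a]%:P - P.[a]%:P * Q) a.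
  by rewrite rootE !hornerE mulrC subrr.
move=> /factor_theorem[W WE].
exists (P.[a] / Q.[a]), (fun d => W.[d] / (Q.[d] * Q.[a])); split.
  exists W, (Q * Q.[a]%:P); split; last by apply: nearW => d; rewrite !hornerE.
  by rewrite /nonvanishing !hornerE mulf_neq0.
have Q0 := cofin_neq0 (den_neq0 (den_nonvanishing a) Qa).
near=> d; have -> : f d = P.[d] / Q.[d] by near: d.
have Qd : Q.[d] != 0 by near: d.
have e := congr1 (horner^~ d) WE; rewrite !hornerE in e.
have -> : (d - a) * (W.[d] / (Q.[d] * Q.[a])) =
   (P.[d] * Q.[a] - P.[a] * Q.[d]) / (Q.[d] * Q.[a]) by rewrite e; ring.
by field; rewrite ?Qd ?andbT; exact: Qa.
Unshelve. all: by end_near.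
Qed.

(** After clearing denominators, evaluation at a shows that a constant that is
    divisible by d - a among the functions regular at a is zero. *)
Lemma regular_cst_eq0 a c h : ratfun (nonvanishing a) h ->
  (\forall d \near @cofin R, c = (d - a) * h d) -> c = 0.
Proof.
move=> [P [Q [Qa hE]]] cE.
have Q0 := cofin_neq0 (den_neq0 (den_nonvanishing a) Qa).
have : c%:P * Q - ('X - a%:P) * P = 0.
  apply: cofin_eq0; near=> d; rewrite !hornerE.
  have Qd : Q.[d] != 0 by near: d.
  have -> : c = (d - a) * (P.[d] / Q.[d]).
    by rewrite -(_ : h d = P.[d] / Q.[d]); near: d.
  by field.
move=> /(congr1 (horner^~ a)); rewrite !hornerE subrr mul0r subr0 => /eqP.
by rewrite mulf_eq0 (negbTE Qa) orbF => /eqP.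
Unshelve. all: by end_near.
Qed.

Lemma ratfun_pole a f : ratfun nonzero f ->
  exists L, ratfun (nonvanishing a) (fun d => (d - a) ^+ L * f d).
Proof.
move=> [P [Q [Q0 fE]]]; have [L [W Wa QE]] := multiplicity_XsubC Q a.
rewrite Q0 /= rootE in Wa.
exists L; exists P, W; split=> //.
have W0 := cofin_neq0 (den_neq0 (den_nonvanishing a) (Wa : nonvanishing a W)).
have a0 := cofin_neq a; near=> d.
have -> : f d = P.[d] / Q.[d] by near: d.
have Wd : W.[d] != 0 by near: d.
have dd : (d - a) ^+ L != 0 by rewrite expf_neq0 //; near: d.
rewrite QE hornerM horner_exp hornerXsubC.
by move: dd; set t := (d - a) ^+ L => dd; field; rewrite Wd dd.
Unshelve. all: by end_near.
Qed.
End Rational.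

(** * Families of functions depending rationally on the dimension parameter *)
Section Families.
Context (R : realType) (m : nat) (A S : set 'rV[R]_m) (dS : reldom A S).
Context (U : {poly R} -> Prop) (denU : denominators U).
Implicit Types F G : R -> 'rV[R]_m -> R.

Definition eq_dfam F G := \forall d \near @cofin R, forall p, S p -> F d p = G d p.

(** C^oo(S) tensored with the rational functions with denominators in U, where
    families that agree on S for all but finitely many d are identified.  As the
    ring is generated by smooth functions and scalars, the product rule makes it
    stable under differential operators. *)
Inductive dfam : (R -> 'rV[R]_m -> R) -> Prop :=
| dfam_smooth f : Cinf A S f -> dfam (fun=> f)
| dfam_scalar a : ratfun U a -> dfam (fun d _ => a d)
| dfamD F G : dfam F -> dfam G -> dfam (fun d p => F d p + G d p)
| dfamM F G : dfam F -> dfam G -> dfam (fun d p => F d p * G d p)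
| eq_in_dfam F G : eq_dfam F G -> dfam F -> dfam G.

Lemma dfam_Cinf F : dfam F -> \forall d \near @cofin R, Cinf A S (F d).
Proof.
elim=> {F} [f Cf|a _|F G _ CF _ CG|F G _ CF _ CG|F G FG _ CF].
- exact: nearW.
- by apply: nearW => d; exact: (Cinf_cst dS).
- by apply: filterS2 CF CG => d; exact: (CinfD dS).
- by apply: filterS2 CF CG => d; exact: (CinfM dS).
by apply: filterS2 FG CF => d; exact: (eq_Cinf dS).
Qed.

Lemma dfam_at F p : dfam F -> S p -> ratfun U (F^~ p).
Proof.
move=> fF Sp; elim: fF => {F} [f Cf|a Ka|F G _ KF _ KG|F G _ KF _ KG|F G FG _ KF].
- exact: ratfun_cst.
- exact: Ka.
- exact: ratfunD.
- exact: ratfunM.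
by apply: ratfun_eq KF; apply: filterS FG => d; exact.
Qed.

Lemma dfam_cst c : dfam (fun _ _ => c).
Proof. by apply: dfam_scalar; exact: ratfun_cst. Qed.

Lemma dfamN F : dfam F -> dfam (fun d p => - F d p).
Proof.
move=> fF; apply: eq_in_dfam (dfamM (dfam_cst (-1)) fF).
by apply: nearW => d p _; rewrite mulN1r.
Qed.

Lemma dfamX F k : dfam F -> dfam (fun d p => F d p ^+ k).
Proof.
move=> fF; elim: k => [|k IH]; first exact: dfam_cst.
by apply: eq_in_dfam (dfamM fF IH); apply: nearW => d p _; rewrite exprS.
Qed.

Lemma dfam_sum (I : eqType) (s : seq I) (F : I -> R -> 'rV[R]_m -> R) :
  (forall i, i \in s -> dfam (F i)) -> dfam (fun d p => \sum_(i <- s) F i d p).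
Proof.
elim: s => [|i s IH] fF.
  by apply: eq_in_dfam (dfam_cst 0); apply: nearW => d p _; rewrite big_nil.
apply: eq_in_dfam (dfamD (fF i _) (IH _)) => [| |j js].
- by apply: nearW => d p _; rewrite big_cons.
- exact: mem_head.
by apply: fF; rewrite inE js orbT.
Qed.

Lemma dfam_pd F k : dfam F -> dfam (fun d p => pd A k (F d) p).
Proof.
elim=> {F} [f Cf|a _|F G fF IF fG IG|F G fF IF fG IG|F G FG fF IF].
- by apply: dfam_smooth; exact: Cinf_pd.
- apply: eq_in_dfam (dfam_cst 0); apply: nearW => d p Sp.
  by rewrite (pd_cst dS).
- apply: eq_in_dfam (dfamD IF IG).
  apply: filterS2 (dfam_Cinf fF) (dfam_Cinf fG) => d CF CG p Sp.
  by rewrite (pdD dS).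
- apply: eq_in_dfam (dfamD (dfamM IF fG) (dfamM fF IG)).
  apply: filterS2 (dfam_Cinf fF) (dfam_Cinf fG) => d CF CG p Sp.
  by rewrite (pdM dS).
apply: eq_in_dfam IF; apply: filterS2 FG (dfam_Cinf fF) => d FG CF p Sp.
exact: (smooth_eq_pd dS).
Qed.

End Families.

Lemma regular_dfam (R : realType) (m : nat) (A S : set 'rV[R]_m) (a : R) F :
  dfam A S (nonvanishing a) F -> dfam A S (@nonzero R) F.
Proof.
elim=> {F} [f Cf|b Kb|F G _ fF _ fG|F G _ fF _ fG|F G FG _ fF].
- exact: dfam_smooth.
- by apply: dfam_scalar; exact: regular_ratfun Kb.
- exact: dfamD.
- exact: dfamM.
exact: eq_in_dfam FG fF.
Qed.

Section ChartFamilies.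
Context (R : realType) (n : nat) (X : topologicalType) (g : riemannian R n X)
  (V : set X) (Vopen : open V) (i : chart g).
Context (U : {poly R} -> Prop) (denU : denominators U).
Local Notation H := (@halfspace R n).
Local Notation S := (phi g i @` (dom g i `&` V)).
Local Notation fam := (dfam H S U).
Let dS := chart_reldom Vopen i.

Lemma dfam_grad F a : fam F -> fam (fun d p => grad i (F d) a p).
Proof.
move=> fF; apply: (dfam_sum denU) => b _; apply: dfamM.
  by apply: dfam_smooth; exact: Cinf_ginv.
exact: (dfam_pd dS).
Qed.

Lemma dfam_gam F G : fam F -> fam G -> fam (fun d p => nabla_grad i (F d) (G d) p).
Proof.
move=> fF fG; apply: (dfam_sum denU) => b _; apply: dfamM.
  exact: dfam_grad.
exact: (dfam_pd dS).
Qed.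

Lemma dfam_lap F : fam F -> fam (fun d p => laplacian i (F d) p).
Proof.
move=> fF; apply: dfamM.
  apply: dfam_smooth; apply: (CinfV dS); last exact: Cinf_voldens.
  exact: voldens_neq0.
apply: (dfam_sum denU) => b _; apply: (dfam_pd dS denU).
apply: dfamM; first by apply: dfam_smooth; exact: Cinf_voldens.
exact: dfam_grad.
Qed.

End ChartFamilies.

(** The goal is matched syntactically, since unification would unfold the
    differential operators. *)
Ltac dfam_arith den := repeat lazymatch goal with
  | |- dfam _ _ _ (fun=> fun=> ?c) => exact (dfam_cst _ _ den c)
  | |- dfam _ _ _ (fun d p => (@?F d p + @?G d p)) => apply (@dfamD _ _ _ _ _ F G)
  | |- dfam _ _ _ (fun d p => (@?F d p * @?G d p)) => apply (@dfamM _ _ _ _ _ F G)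
  | |- dfam _ _ _ (fun d p => (- @?F d p)) => apply (@dfamN _ _ _ _ _ den F)
  | |- dfam _ _ _ (fun d p => (@?F d p ^+ ?k)) => apply (@dfamX _ _ _ _ _ den F k)
  | C : dfam _ _ _ ?F |- dfam _ _ _ (fun d p => ?F d p) => exact C
  | C : dfam _ _ _ (fun=> ?f) |- dfam _ _ _ (fun d p => ?f p) => exact C
  | C : dfam _ _ _ ?F |- dfam _ _ _ ?F => exact C
  end.

(** * Expansions in powers of the defining function *)
Section Expansions.
Context (R : realType) (n : nat) (X : topologicalType) (g : riemannian R n X)
  (V : set X) (Vopen : open V) (i : chart g).
Local Notation H := (@halfspace R n).
Local Notation S := (phi g i @` (dom g i `&` V)).
Local Notation smooth := (Cinf H S).
Local Notation gam := (nabla_grad i).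
Local Notation lap := (laplacian i).
Context (r : 'rV[R]_n.+1 -> R) (Cr : smooth r).
Hypothesis gam_r : forall p, S p -> gam r r p = 1.
Let dS := chart_reldom Vopen i.
Implicit Types (A B f s u w : 'rV[R]_n.+1 -> R) (p q : 'rV[R]_n.+1) (d lam : R).

Lemma gam_exp f k p : S p ->
  gam f (fun q => r q ^+ k.+1) p = k.+1%:R * r p ^+ k * gam f r p.
Proof.
move=> Sp; elim: k => [|k IH]; first by rewrite expr0 !mul1r.
under [X in gam f X]eq_fun do rewrite exprS.
rewrite (gamMr Vopen) ?IH //; last exact: (CinfX dS).
by rewrite !exprS -[k.+2%:R]natr1; ring.
Qed.

(** For k = 0 the truncated exponent k.-1 is harmless: its coefficient is zero. *)
Lemma lap_exp k p : S p -> lap (fun q => r q ^+ k.+1) p =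
  k.+1%:R * r p ^+ k * lap r p + k.+1%:R * k%:R * r p ^+ k.-1.
Proof.
move=> Sp; elim: k => [|k IH]; first by rewrite expr0 mulr0 mul0r addr0 !mul1r.
under [X in lap X]eq_fun do rewrite exprS.
rewrite (lapM Vopen) ?IH //; last exact: (CinfX dS).
rewrite gam_exp // gam_r // -[k.+2%:R]natr1 -[k.+1%:R]natr1 /=.
case: k {IH} => [|k] /=; first by rewrite !expr0 expr1; ring.
by rewrite !exprS -[k.+1%:R]natr1; ring.
Qed.

Lemma gam_expM f B k p : smooth B -> S p ->
  gam f (fun q => r q ^+ k.+1 * B q) p =
  k.+1%:R * r p ^+ k * B p * gam f r p + r p ^+ k.+1 * gam f B p.
Proof.
move=> CB Sp; rewrite (gamMr Vopen) //; last exact: (CinfX dS).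
by rewrite gam_exp //; ring.
Qed.

Lemma lap_expM B k p : smooth B -> S p ->
  lap (fun q => r q ^+ k.+1 * B q) p =
  k.+1%:R * k%:R * r p ^+ k.-1 * B p + r p ^+ k *
  (r p * lap B p + k.+1%:R * (B p * lap r p + 2 * gam B r p)).
Proof.
move=> CB Sp; rewrite (lapM Vopen) //; last exact: (CinfX dS).
rewrite lap_exp // (gamC _ B Sp) gam_exp // exprS.
(* Here and below, atoms are generalized because ring compares them up to conversion,
   which would unfold the differential operators. *)
by move: (lap r p) (lap B p) (gam B r p) (B p) => *; ring.
Qed.

(** Boundary defining functions that agree with r to first order; A collects the
    coefficients of all higher powers of r. *)
Definition defining A q := r q + r q ^+ 2 * A q.

Lemma Cinf_defining A : smooth A -> smooth (defining A).
Proof.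
by move=> CA; apply: (CinfD dS) => //; apply: (CinfM dS) => //; exact: (CinfX dS).
Qed.

Lemma gam_defining A p : smooth A -> S p ->
  gam (defining A) r p = 1 + r p * (2 * A p + r p * gam A r p).
Proof.
move=> CA Sp; rewrite (gamC _ r Sp) /defining (gamDr Vopen) //; last first.
  by apply: (CinfM dS) => //; exact: (CinfX dS).
by rewrite gam_expM // gam_r // (gamC A r Sp); ring.
Qed.

(** The factor of r^(k+2) in [Sop_perturb], collecting the terms that are not of
    lowest order. *)
Definition S_rest d k A B p :=
  2 * (k.+2%:R * B p * (2 * A p + r p * gam A r p) + gam (defining A) B p)
  + k.+2%:R * B p * r p ^+ k * (k.+2%:R * B p + r p * gam B r p)
  + gam B (fun q => r q ^+ k.+2 * B q) p
  - 2 / (d + 1) * (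
    (1 + r p * A p) *
      (r p * lap B p + k.+2%:R * (B p * lap r p + 2 * gam B r p))
    + A p * (k.+2%:R * k.+1%:R * B p)
    + B p * (lap (defining A) p + lap (fun q => r q ^+ k.+2 * B q) p
             + J i d p * (2 * defining A p + r p ^+ k.+2 * B p))).

(** The goal is matched syntactically, since unification would unfold the
    differential operators. *)
Ltac smooth_arith := repeat lazymatch goal with
  | |- Cinf _ _ (fun=> ?c) => exact: (@Cinf_cst _ _ _ _ dS c)
  | |- Cinf _ _ (fun q => (@?f q + @?h q)) => apply: (@CinfD _ _ _ _ dS f h)
  | |- Cinf _ _ (fun q => (@?f q * @?h q)) => apply: (@CinfM _ _ _ _ dS f h)
  | |- Cinf _ _ (fun q => (- @?f q)) => apply: (@CinfN _ _ _ _ dS f)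
  | |- Cinf _ _ (fun q => (@?f q ^+ ?k)) => apply: (@CinfX _ _ _ _ dS f k)
  | C : Cinf _ _ ?f |- Cinf _ _ (fun q => ?f q) => exact C
  | C : Cinf _ _ ?f |- Cinf _ _ ?f => exact C
  end.

Lemma Cinf_J d : smooth (J i d).
Proof. by apply: (CinfM dS); [exact: Cinf_scal | exact: (Cinf_cst dS)]. Qed.

Lemma Cinf_S_rest d k A B : smooth A -> smooth B -> smooth (S_rest d k A B).
Proof.
move=> CA CB; have Cs := Cinf_defining CA; have Cc c := Cinf_cst dS c.
have Ce : smooth (fun q => r q ^+ k.+2 * B q).
  by apply: (CinfM dS) => //; exact: (CinfX dS).
(* The differential expressions are generalized so that only a polynomial in
   smooth functions remains. *)
rewrite /S_rest.
move: (Cinf_J d); move: (J i d) => f1 C1.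
move: (Cinf_gam Vopen CA Cr); move: (gam A r) => f2 C2.
move: (Cinf_gam Vopen CB Cr); move: (gam B r) => f3 C3.
move: (Cinf_gam Vopen Cs CB); move: (gam (defining A) B) => f4 C4.
move: (Cinf_gam Vopen CB Ce); move: (gam B (fun q => r q ^+ k.+2 * B q)) => f5 C5.
move: (Cinf_lap Vopen CB); move: (lap B) => f6 C6.
move: (Cinf_lap Vopen Cr); move: (lap r) => f7 C7.
move: (Cinf_lap Vopen Cs); move: (lap (defining A)) => f8 C8.
move: (Cinf_lap Vopen Ce); move: (lap (fun q => r q ^+ k.+2 * B q)) => f9 C9.
move: Cs; move: (defining A) => s Cs {Ce}.
by smooth_arith.
Qed.

(** A perturbation r^(k+2) B of sigma meets the lowest possible power r^(k+1) of r in
    two places only: in 2 <grad sigma, grad (r^(k+2) B)>, and, through the second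
    radial derivative in the Laplacian, in 2 sigma rho.  Since
    2 (k+2) - 2 (k+2) (k+1) / (d+1) = 2 (k+2) (d-k) / (d+1), the coefficient of
    r^(k+2) in sigma is determined unless d = k. *)
Lemma Sop_perturb d k A B p : smooth A -> smooth B -> S p ->
  Sop i d (fun q => defining A q + r q ^+ k.+2 * B q) p =
  Sop i d (defining A) p
  + (2 * k.+2%:R - 2 * k.+2%:R * k.+1%:R / (d + 1)) * r p ^+ k.+1 * B p
  + r p ^+ k.+2 * S_rest d k A B p.
Proof.
move=> CA CB Sp; set s := defining A; set e := fun q => r q ^+ k.+2 * B q.
have Cs : smooth s by exact: Cinf_defining.
have Ce : smooth e by apply: (CinfM dS) => //; exact: (CinfX dS).
have Ge f : gam f e p = k.+2%:R * r p ^+ k.+1 * B p * gam f r p + r p ^+ k.+2 * gam f B p.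
  exact: gam_expM.
have Le : lap e p = k.+2%:R * k.+1%:R * r p ^+ k * B p + r p ^+ k.+1 *
    (r p * lap B p + k.+2%:R * (B p * lap r p + 2 * gam B r p)) by exact: lap_expM.
have E1 : gam (fun q => s q + e q) (fun q => s q + e q) p =
    gam s s p + 2 * gam s e p + gam e e p.
  rewrite (gamDr Vopen _ Cs Ce Sp) (gamC _ s Sp) (gamC (fun q => _) e Sp).
  by rewrite !(gamDr Vopen _ Cs Ce Sp) (gamC e s Sp); ring.
rewrite /Sop /rho (lapD Vopen) // E1 Le (Ge s) (Ge e) gam_defining //.
rewrite (gamC e r Sp) (gamC e B Sp) (Ge r) gam_r // (gamC r B Sp).
rewrite /S_rest -/s -/e Le.
have -> : s p = r p + r p ^+ 2 * A p by [].
rewrite !exprS.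
move: (gam s s p) (gam A r p) (gam s B p) (gam B r p) (gam B e p) (gam B B p).
move: (lap s p) (lap B p) (lap r p) (J i d p) (r p ^+ k) (A p) (B p) (r p).
by move: (k.+2%:R) (k.+1%:R) (d + 1)^-1 => *; ring.
Qed.

Definition L_rest d lam k A w p :=
  (d + 2 * lam - 1) * (k.+1%:R * w p * (2 * A p + r p * gam A r p)
     + gam (defining A) w p + lam * rho i d (defining A) p * w p)
  - ((1 + r p * A p) * (r p * lap w p + k.+1%:R * (w p * lap r p + 2 * gam w r p))
     + A p * (k.+1%:R * k%:R * w p) + defining A p * (lam * J i d p * w p)).

(** L lowers the order of vanishing on M by one.  The leading coefficient combines
    (d + 2 lam - 1) (k+1) from the gradient term with - (k+1) k from the second radial
    derivative in sigma Delta. *)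
Lemma Lop_expM d lam k A w p : smooth A -> smooth w -> S p ->
  Lop i d (defining A) lam (fun q => r q ^+ k.+1 * w q) p =
  k.+1%:R * (d + 2 * lam - 1 - k%:R) * r p ^+ k * w p
  + r p ^+ k.+1 * L_rest d lam k A w p.
Proof.
move=> CA Cw Sp; rewrite /Lop gam_expM // lap_expM // gam_defining //.
rewrite /L_rest; set rh := rho _ _ _ _.
have -> : defining A p = r p + r p ^+ 2 * A p by [].
have -> : (r p + r p ^+ 2 * A p) * (k.+1%:R * k%:R * r p ^+ k.-1 * w p + r p ^+ k *
   (r p * lap w p + k.+1%:R * (w p * lap r p + 2 * gam w r p)) +
   lam * J i d p * (r p ^+ k.+1 * w p)) =
  (1 + r p * A p) * (k.+1%:R * k%:R * r p ^+ k * w p + r p ^+ k.+1 *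
   (r p * lap w p + k.+1%:R * (w p * lap r p + 2 * gam w r p)) +
   r p * (lam * J i d p * (r p ^+ k.+1 * w p))).
  move: (lap r p) (lap w p) (gam w r p) (A p) (w p) (J i d p) (r p) => *.
  by case: k => [|k]; rewrite /= ?expr0 !exprS; ring.
rewrite !exprS; move: (gam A r p) (gam (defining A) w p).
by move: (lap r p) (lap w p) (gam w r p) (A p) (w p) (J i d p) (r p) => *; ring.
Qed.
End Expansions.

(** * Families of functions on the boundary *)
Section BoundaryFamilies.
Context (R : realType) (n : nat) (X : topologicalType) (B : bmanifold R n X).
Implicit Types (F G : R -> X -> R) (u : X -> R).

Inductive bdfam (U : {poly R} -> Prop) : (R -> X -> R) -> Prop :=
| bdfam1 u b : Cinf_bd B u -> ratfun U b -> bdfam U (fun d x => u x * b d)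
| bdfamD F G : bdfam U F -> bdfam U G ->
    bdfam U (fun d x => F d x + G d x)
| eq_bdfam F G :
    (\forall d \near @cofin R, forall x, bd B x -> F d x = G d x) ->
    bdfam U F -> bdfam U G.

Lemma bdfamZ U b F : denominators U -> ratfun U b -> bdfam U F ->
  bdfam U (fun d x => b d * F d x).
Proof.
move=> denU Kb; elim=> {F} [u b' Cu Kb'|F G _ bF _ bG|F G FG _ bF].
- apply: eq_bdfam (bdfam1 Cu (ratfunM denU Kb Kb')).
  by apply: nearW => d x _; ring.
- apply: eq_bdfam (bdfamD bF bG).
  by apply: nearW => d x _; ring.
by apply: eq_bdfam bF; apply: filterS FG => d FG x bx; rewrite FG.
Qed.

Lemma rational_bdfam F : Cinf_bd B (fun=> 0) -> rational_Cinf_bd B F ->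
  bdfam (@nonzero R) F.
Proof.
move=> C0 [q [m [u [q0 Cu FE]]]].
have bS k : bdfam (@nonzero R) (fun d x => \sum_(j < k) u j x * (d ^+ j / q.[d])).
  elim: k => [|k IH].
    apply: eq_bdfam (bdfam1 C0 (ratfun_cst (@den_nonzero R) 0)).
    by apply: nearW => d x _; rewrite mul0r big_ord0.
  have Kb : ratfun (@nonzero R) (fun d => d ^+ k / q.[d]).
    by exists 'X^k, q; split=> //; apply: nearW => d; rewrite hornerXn.
  apply: eq_bdfam (bdfamD IH (bdfam1 (Cu k) Kb)).
  by apply: nearW => d x _; rewrite big_ord_recr.
apply: eq_bdfam (bS m); apply: filterS (cofin_neq0 q0) => d qd x bx.
by rewrite FE // mulr_suml; apply: eq_bigr => j _; rewrite mulrA.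
Qed.

Variable a : R.
Local Notation reg := (nonvanishing a).

(** Taylor expansion at d = a to first order, term by term in the tensor product. *)
Lemma bdfam_split F : bdfam reg F -> exists (u : X -> R) G, bdfam reg G /\
  \forall d \near @cofin R, forall x, bd B x -> F d x = u x + (d - a) * G d x.
Proof.
elim=> {F} [u b Cu Kb|F G _ [uF [F' [bF FE]]] _ [uG [G' [bG GE]]]
  |F G FG _ [u [F' [bF FE]]]].
- have [c [h [Kh bE]]] := regular_split Kb.
  exists (fun x => u x * c), (fun d x => u x * h d); split; first exact: bdfam1.
  by apply: filterS bE => d -> x _; ring.
- exists (fun x => uF x + uG x), (fun d x => F' d x + G' d x).
  split; first exact: bdfamD.
  by apply: filterS2 FE GE => d FE GE x bx; rewrite FE // GE //; ring.
exists u, F'; split => //.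
by apply: filterS2 FG FE => d FG FE x bx; rewrite -FG // FE.
Qed.

Lemma bdfam_pole F : bdfam (@nonzero R) F ->
  exists L, bdfam reg (fun d x => (d - a) ^+ L * F d x).
Proof.
have denr := den_nonvanishing a.
have Kd k : ratfun reg (fun d => (d - a) ^+ k).
  apply: ratfun_eq (ratfun_poly denr (('X - a%:P) ^+ k)).
  by apply: nearW => d; rewrite horner_exp hornerXsubC.
elim=> {F} [u b Cu Kb|F G _ [k bF] _ [l bG]|F G FG _ [k bF]].
- have [k Kk] := ratfun_pole a Kb; exists k.
  by apply: eq_bdfam (bdfam1 Cu Kk); apply: nearW => d x _; ring.
- exists (k + l)%N.
  apply: eq_bdfam (bdfamD (bdfamZ denr (Kd l) bF) (bdfamZ denr (Kd k) bG)).
  by apply: nearW => d x _; rewrite exprD; ring.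
by exists k; apply: eq_bdfam bF; apply: filterS FG => d FG x bx; rewrite FG.
Qed.

(** Regularity of a rational family can be tested pointwise.  While a power of
    d - a is left in the denominator, the numerator vanishes at d = a at every point of
    M, so that this power can be lowered by one within smooth families. *)
Lemma bdfam_regular F : bdfam (@nonzero R) F ->
  (forall x, bd B x -> ratfun reg (F^~ x)) -> bdfam reg F.
Proof.
move=> /bdfam_pole[L bF] KF; have denr := den_nonvanishing a.
elim: L bF => [|L IH] bF.
  by apply: eq_bdfam bF; apply: nearW => d x _; rewrite mul1r.
apply: IH; have [u [G [bG FE]]] := bdfam_split bF.
have KG x : bd B x -> ratfun reg (G^~ x).
  move=> bx; elim: bG => {G FE} [u' b _ Kb|F' G _ KF' _ KG|F' G FG _ KF'].
  - exact: (ratfunM denr (ratfun_cst denr (u' x)) Kb).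
  - exact: ratfunD.
  by apply: ratfun_eq KF'; apply: filterS FG => d ->.
have Kd : ratfun reg (fun d => (d - a) ^+ L).
  apply: ratfun_eq (ratfun_poly denr (('X - a%:P) ^+ L)).
  by apply: nearW => d; rewrite horner_exp hornerXsubC.
have u0 x : bd B x -> u x = 0.
  move=> bx; apply: (@regular_cst_eq0 _ a (u x) (fun d => (d - a) ^+ L * F d x - G d x)).
    apply: ratfun_eq (ratfunD denr (ratfunM denr Kd (KF x bx))
      (ratfunM denr (ratfun_cst denr (-1)) (KG x bx))).
    by apply: nearW => d; rewrite mulN1r.
  apply: filterS FE => d /(_ x bx); rewrite exprS => e.
  by rewrite mulrBr mulrA e addrK.
apply: eq_bdfam bG; apply: filterS2 FE (cofin_neq a) => d FE da x bx.
apply: (mulfI da); have := FE x bx; rewrite u0 // add0r => <-.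
by rewrite mulrA -exprS.
Qed.

End BoundaryFamilies.

(** * Orders of vanishing on the boundary *)
Section RadialDerivative.
Context (R : realType) (n : nat) (X : topologicalType) (g : riemannian R n X)
  (V : set X) (Vopen : open V) (i : chart g).
Local Notation H := (@halfspace R n).
Local Notation S := (phi g i @` (dom g i `&` V)).
Local Notation smooth := (Cinf H S).
Local Notation gam := (nabla_grad i).
Context (r : 'rV[R]_n.+1 -> R) (Cr : smooth r).
Hypothesis gam_r : forall p, S p -> gam r r p = 1.
Let dS := chart_reldom Vopen i.
Implicit Types (f u : 'rV[R]_n.+1 -> R) (p q : 'rV[R]_n.+1).

(** The iterated derivatives along grad r replace Taylor coefficients in r: on M they
    read off the coefficient of r^k without any division by powers of r. *)
Definition radial k f := iter k (gam r) f.

Lemma Cinf_radial k f : smooth f -> smooth (radial k f).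
Proof. by move=> Cf; elim: k => //= k IH; exact: Cinf_gam. Qed.

Lemma eq_radial k f u p : smooth f -> (forall q, S q -> f q = u q) -> S p ->
  radial k f p = radial k u p.
Proof.
move=> Cf fu; elim: k p => [|k IH] p Sp /=; first exact: fu.
by apply: (eq_gam Vopen _ _ _ Sp) => [|q Sq]; [exact: Cinf_radial | exact: IH].
Qed.

Lemma radialD k f u p : smooth f -> smooth u -> S p ->
  radial k (fun q => f q + u q) p = radial k f p + radial k u p.
Proof.
move=> Cf Cu; elim: k p => [|k IH] p Sp //=.
rewrite -(gamDr Vopen) //; try exact: Cinf_radial.
apply: (eq_gam Vopen _ _ IH Sp); exact: Cinf_radial (CinfD dS Cf Cu).
Qed.

Lemma radialZ k c f p : smooth f -> S p ->
  radial k (fun q => c * f q) p = c * radial k f p.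
Proof.
move=> Cf; elim: k p => [|k IH] p Sp //=.
have Cc : smooth (fun=> c) by exact: (Cinf_cst dS).
transitivity (gam r (fun q => c * radial k f q) p).
  apply: (eq_gam Vopen _ _ IH Sp); exact: Cinf_radial (CinfM dS Cc Cf).
rewrite (gamMr Vopen _ Cc) //; last exact: Cinf_radial.
by rewrite (gam_cst Vopen) // mulr0 addr0.
Qed.

(** As <grad r, grad r> = 1, the derivative along grad r of r^(k+1) f is r^k times
    (k+1) f + r <grad r, grad f>; hence each derivative lowers the exponent by one. *)
Lemma radial_expM k l f : smooth f -> exists h, [/\ smooth h,
  forall p, S p -> radial k (fun q => r q ^+ (k + l) * f q) p = r p ^+ l * h p &
  l = 0%N -> forall p, S p -> r p = 0 -> h p = k`!%:R * f p].
Proof.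
elim: k f => [|k IH] f Cf.
  by exists f; split=> // _ p _ _; rewrite mul1r.
pose f' q := (k + l).+1%:R * f q + r q * gam r f q.
have Cf' : smooth f'.
  apply: (CinfD dS); apply: (CinfM dS) => //; first exact: (Cinf_cst dS).
  exact: Cinf_gam.
have [h [Ch hE h0]] := IH _ Cf'; exists h; split=> // [p Sp|l0 p Sp rp].
  rewrite -hE // /radial iterSr; apply: eq_radial Sp => [|q Sq].
    by apply: (Cinf_gam Vopen) => //; apply: (CinfM dS) => //; exact: (CinfX dS).
  by rewrite addSn (gam_expM Vopen) // gam_r // /f' exprS; ring.
by rewrite h0 // /f' rp mul0r addr0 l0 addn0 factS mulnC natrM mulrA.
Qed.

Lemma radial_top k f p : smooth f -> S p -> r p = 0 ->
  radial k (fun q => r q ^+ k * f q) p = k`!%:R * f p.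
Proof.
move=> Cf Sp rp; have [h [_ hE h0]] := radial_expM k 0 Cf.
by have := hE p Sp; rewrite addn0 expr0 mul1r h0.
Qed.

Lemma radial_low k l f p : (k < l)%N -> smooth f -> S p -> r p = 0 ->
  radial k (fun q => r q ^+ l * f q) p = 0.
Proof.
move=> kl Cf Sp rp; have [h [_ hE _]] := radial_expM k (l - k) Cf.
have := hE p Sp; rewrite subnKC 1?ltnW // => ->.
by rewrite rp expr0n subn_eq0 leqNgt kl mul0r.
Qed.

End RadialDerivative.

(** * Varying the dimension parameter *)
Section DimensionShift.
Context (R : realType) (n : nat) (X : topologicalType) (g : riemannian R n X)
  (V : set X) (Vopen : open V) (i : chart g).
Hypothesis n_gt0 : (0 < n)%N.
Local Notation H := (@halfspace R n).
Local Notation S := (phi g i @` (dom g i `&` V)).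
Local Notation smooth := (Cinf H S).
Local Notation gam := (nabla_grad i).
Local Notation lap := (laplacian i).
Local Notation a := (n%:R : R).
Local Notation reg := (nonvanishing a).
Local Notation fam := (dfam H S reg).
Let dS := chart_reldom Vopen i.
Let denr : denominators reg := den_nonvanishing a.

Lemma regular_V_dim : ratfun reg (fun d => d^-1).
Proof.
have U : reg 'X by rewrite /nonvanishing hornerX pnatr_eq0 -lt0n.
by apply: ratfun_eq (ratfunV U); apply: nearW => d; rewrite hornerX.
Qed.

Lemma regular_V_dim1 : ratfun reg (fun d => (d + 1)^-1).
Proof.
have U : reg ('X + 1%:P) by rewrite /nonvanishing !hornerE natr1 pnatr_eq0.
by apply: ratfun_eq (ratfunV U); apply: nearW => d; rewrite !hornerE.
Qed.

Lemma dfam_J : fam (fun d p => J i d p).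
Proof.
have C := dfam_smooth reg (Cinf_scal Vopen (i := i)).
apply: eq_in_dfam (dfamM C (dfamM (dfam_cst H S denr 2^-1)
  (dfam_scalar H S regular_V_dim))).
by apply: nearW => d p _; rewrite /J invfM.
Qed.

(** Both d and the defining function move by a multiple of d - n, and S depends on them
    through functions regular at d = n, so S moves by a multiple of d - n as well.  The
    witness G collects the differences 1/(d+1) - 1/(n+1) and 1/(2d) - 1/(2n), divided
    by d - n, and the terms of S that contain tau. *)
Lemma Sop_shift s tau : smooth s -> fam tau -> exists G, fam G /\
  \forall d \near @cofin R, forall p, S p ->
    Sop i d (fun q => s q + (d - a) * tau d q) p = Sop i a s p + (d - a) * G d p.
Proof.
move=> Cs ft.
have fs : fam (fun=> s) by exact: dfam_smooth.
have fd : fam (fun d _ => d^-1) := dfam_scalar H S regular_V_dim.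
have fd1 : fam (fun d _ => (d + 1)^-1) := dfam_scalar H S regular_V_dim1.
have fsc : fam (fun=> scal i) by apply: dfam_smooth; exact: Cinf_scal.
have fJ := dfam_J.
have fls := dfam_lap Vopen denr fs.
have flt := dfam_lap Vopen denr ft.
have fid : fam (fun d _ => d) by apply: dfam_scalar; exact: ratfun_id.
exists (fun d p =>
  2 * gam s (tau d) p + (d - a) * gam (tau d) (tau d) p
  + 2 * (d + 1)^-1 * (tau d p * (- lap s p - s p * J i d p)
      - (s p + (d - a) * tau d p) * (lap (tau d) p + tau d p * J i d p))
  + 2 * s p * (s p * scal i p * (2 * a)^-1 * d^-1 * (d + 1)^-1
       - (- lap s p - s p * J i a p) * (a + 1)^-1 * (d + 1)^-1)).
split.
  have fJa : fam (fun=> J i a).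
    by apply: dfam_smooth; apply: (CinfM dS); [exact: Cinf_scal | exact: (Cinf_cst dS)].
  have fgst := dfam_gam Vopen denr fs ft.
  have fgtt := dfam_gam Vopen denr ft ft.
  by dfam_arith denr.
have a0 : a != 0 by rewrite pnatr_eq0 -lt0n.
have a1 : a + 1 != 0 by rewrite natr1 pnatr_eq0.
have d0 : \forall d \near @cofin R, d != 0.
  by apply: filterS (cofin_neq 0) => d; rewrite subr0.
have d1 : \forall d \near @cofin R, d + 1 != 0.
  by apply: filterS (cofin_neq (-1)) => d; rewrite opprK.
have Ct := dfam_Cinf dS ft; near=> d => p Sp.
have Ctd : smooth (tau d) by near: d.
have Cc : smooth (fun=> d - a) by exact: (Cinf_cst dS).
have Ce : smooth (fun q => (d - a) * tau d q) by exact: (CinfM dS).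
have Gs f : gam f (fun q => s q + (d - a) * tau d q) p =
    gam f s p + (d - a) * gam f (tau d) p.
  by rewrite (gamDr Vopen) // (gamMr Vopen _ Cc) // (gam_cst Vopen) // mulr0 addr0.
have Ls : lap (fun q => s q + (d - a) * tau d q) p = lap s p + (d - a) * lap (tau d) p.
  rewrite (lapD Vopen) // (lapM Vopen Cc) // (lap_cst Vopen) // (gamC _ _ Sp).
  by rewrite (gam_cst Vopen) // !mulr0 !addr0.
have dn0 : d != 0 by near: d.
have dn1 : d + 1 != 0 by near: d.
pose sd q := s q + (d - a) * tau d q.
have GG : gam sd sd p = gam s s p + 2 * (d - a) * gam s (tau d) p
    + (d - a) ^+ 2 * gam (tau d) (tau d) p.
  rewrite {2}/sd Gs (gamC sd s Sp) (gamC sd (tau d) Sp) {1 2}/sd !Gs.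
  by rewrite (gamC (tau d) s Sp); ring.
rewrite /Sop /rho Ls -/sd GG.
rewrite /J; field; rewrite ?dn0 ?dn1 ?a0 ?a1 //.
Unshelve. all: by end_near.
Qed.
End DimensionShift.

(** * The pole of the extrinsic Q-curvature *)

(** Below, sigma = s + r^(n+2) W with s regular at d = n, so that the pole of sigma sits
    in W.  Every function met in the composition of the operators L is the sum of
    a regular family U and r^k w with w rational, and only the values of w on M
    matter.  The other form, sigma = r + r^2 A, serves to apply the leading term
    formula for L. *)
Section QStep.
Context (R : realType) (n : nat) (X : topologicalType) (g : riemannian R n X)
  (V : set X) (Vopen : open V) (i : chart g).
Hypothesis n_gt0 : (0 < n)%N.
Local Notation H := (@halfspace R n).
Local Notation S := (phi g i @` (dom g i `&` V)).
Local Notation smooth := (Cinf H S).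
Local Notation gam := (nabla_grad i).
Local Notation lap := (laplacian i).
Local Notation a := (n%:R : R).
Local Notation reg := (nonvanishing a).
Local Notation Reg := (dfam H S reg).
Local Notation Rat := (dfam H S (@nonzero R)).
Let dS := chart_reldom Vopen i.
Let denr : denominators reg := den_nonvanishing a.
Let denR : denominators (@nonzero R) := @den_nonzero R.
Context (r : 'rV[R]_n.+1 -> R) (Cr : smooth r).
Hypothesis gam_r : forall p, S p -> gam r r p = 1.
Context (A s W sg : R -> 'rV[R]_n.+1 -> R).
Hypotheses (fA : Rat A) (fs : Reg s) (fW : Rat W).
Hypothesis sgA : forall d, sg d = defining r (A d).
Hypothesis sgW : forall d, d - a != 0 -> sg d = fun q => s d q + r q ^+ n.+2 * W d q.

Definition tail_lap d p :=
  r p * lap (W d) p + n.+2%:R * (W d p * lap r p + 2 * gam (W d) r p).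

(** The contribution of r^(n+2) W to rho, divided by r^n. *)
Definition rho_pole d p :=
  - (n.+2%:R * n.+1%:R * W d p + r p * tail_lap d p + r p ^+ 2 * (W d p * J i d p))
  * (d + 1)^-1.

Let fR U : dfam H S U (fun=> r).
Proof. exact: dfam_smooth. Qed.

Let near_smooth : \forall d \near @cofin R,
  [/\ d - a != 0, smooth (s d), smooth (W d) & smooth (A d)].
Proof.
have F1 : \forall d \near @cofin R, d - a != 0 /\ smooth (s d).
  by apply: filterI; [exact: cofin_neq | exact: (dfam_Cinf dS fs)].
have F2 : \forall d \near @cofin R, smooth (W d) /\ smooth (A d).
  by apply: filterI; [exact: (dfam_Cinf dS fW) | exact: (dfam_Cinf dS fA)].
by apply: filterS2 F1 F2 => d [? ?] [? ?].
Qed.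

Lemma dfam_d1 U : denominators U -> (forall Q, reg Q -> U Q) ->
  dfam H S U (fun d _ => (d + 1)^-1).
Proof.
move=> denU sub; apply: dfam_scalar.
have [P [Q [rQ e]]] := regular_V_dim1 R n.
by exists P, Q; split=> //; exact: sub.
Qed.

Lemma rho_split d p : d - a != 0 -> smooth (s d) -> smooth (W d) -> S p ->
  rho i d (sg d) p = rho i d (s d) p + r p ^+ n * rho_pole d p.
Proof.
move=> da Cs CW Sp; rewrite /rho sgW //.
have Ce : smooth (fun q => r q ^+ n.+2 * W d q).
  by apply: (CinfM dS) CW; exact: (CinfX dS).
rewrite (lapD Vopen Cs Ce Sp) (lap_expM Vopen Cr gam_r _ CW Sp).
rewrite /rho_pole /tail_lap /= !exprS.
move: (lap r p) (lap (W d) p) (gam (W d) r p) (lap (s d) p) (J i d p) (s d p).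
by move: (W d p) (r p) => *; ring.
Qed.

Lemma dfam_rho_pole : Rat rho_pole.
Proof.
have f1 : Rat (fun d _ => (d + 1)^-1).
  exact: (dfam_d1 denR (den_neq0 denr)).
have f2 : Rat (fun d p => J i d p) by apply: (@regular_dfam _ _ _ _ a); exact: dfam_J.
have f3 := dfam_lap Vopen denR fW.
have f4 := dfam_lap Vopen denR (fR (@nonzero R)).
have f5 := dfam_gam Vopen denR fW (fR (@nonzero R)).
have f6 := fR (@nonzero R).
rewrite /rho_pole /tail_lap; by dfam_arith denR.
Qed.

Lemma dfam_rho F : Reg F -> Reg (fun d p => rho i d (F d) p).
Proof.
move=> fF; have f1 : Reg (fun d _ => (d + 1)^-1) by exact: (dfam_d1 denr (fun Q h => h)).
have f2 : Reg (fun d p => J i d p) by exact: dfam_J.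
have f3 := dfam_lap Vopen denr fF.
by rewrite /rho; dfam_arith denr.
Qed.

(** The pole enters (N-1) rho - sigma J at order r^n, through the second radial
    derivative of r^(n+2) W. *)
Lemma Q_start : exists U w, [/\ Reg U, Rat w &
  \forall d \near @cofin R, forall p, S p ->
    (n.+1%:R - 1) * rho i d (sg d) p - sg d p * J i d p = U d p + r p ^+ n * w d p /\
    (r p = 0 -> w d p = - (n%:R * n.+2%:R * n.+1%:R) * W d p * (d + 1)^-1)].
Proof.
have f2 : Reg (fun d p => J i d p) by exact: dfam_J.
have f3 : Rat (fun d p => J i d p) := regular_dfam f2.
have f4 := dfam_rho_pole; have f5 := dfam_rho fs; have f6 := fR (@nonzero R).
exists (fun d p => (n.+1%:R - 1) * rho i d (s d) p - s d p * J i d p),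
  (fun d p => (n.+1%:R - 1) * rho_pole d p - r p ^+ 2 * W d p * J i d p); split.
- by dfam_arith denr.
- by dfam_arith denR.
apply: filterS near_smooth => d [da Cs CW _] p Sp.
rewrite rho_split // sgW // !exprS expr0; split; first by ring.
by move=> r0; rewrite /rho_pole !exprS r0 -[n.+1%:R]natr1; ring.
Qed.

(** The regular part U is differentiated together with r^(n+2) W only in terms of order
    at least r^n, which vanish faster than r^k; the singular part follows [Lop_expM]. *)
Lemma Lop_step lam k U w u : ratfun reg lam -> (k < n)%N -> Reg U -> Rat w ->
  (\forall d \near @cofin R, forall p, S p -> u d p = U d p + r p ^+ k.+1 * w d p) ->
  exists U' w', [/\ Reg U', Rat w' &
  \forall d \near @cofin R, forall p, S p ->
    Lop i d (sg d) (lam d) (u d) p = U' d p + r p ^+ k * w' d p /\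
    (r p = 0 -> w' d p = k.+1%:R * (d + 2 * lam d - 1 - k%:R) * w d p)].
Proof.
move=> Klam kn fU fw uE.
have fl : Reg (fun d _ => lam d) by exact: dfam_scalar.
have flR : Rat (fun d _ => lam d) := regular_dfam fl.
have fid : Reg (fun d _ => d) by apply: dfam_scalar; exact: ratfun_id.
have fidR : Rat (fun d _ => d) := regular_dfam fid.
have fJ : Reg (fun d p => J i d p) by exact: dfam_J.
have fJR : Rat (fun d p => J i d p) := regular_dfam fJ.
have fUR : Rat U := regular_dfam fU.
have fr := fR (@nonzero R).
pose Q1 d p := (d + 2 * lam d - 1) * (n.+2%:R * r p * W d p * gam (U d) r p
    + r p ^+ 2 * gam (U d) (W d) p + lam d * rho_pole d p * U d p)
  - r p ^+ 2 * W d p * (lap (U d) p + lam d * J i d p * U d p).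
have fQ1 : Rat Q1.
  have f1 := dfam_gam Vopen denR fUR fr; have f2 := dfam_gam Vopen denR fUR fW.
  have f3 := dfam_rho_pole; have f4 := dfam_lap Vopen denR fUR.
  by rewrite /Q1; dfam_arith denR.
have fsgR : Rat (fun d p => defining r (A d) p).
  by rewrite /defining; dfam_arith denR.
have fLr : Rat (fun d p => L_rest i r d (lam d) k (A d) (w d) p).
  have f1 := dfam_gam Vopen denR fA fr; have f2 := dfam_gam Vopen denR fsgR fw.
  have f3 := dfam_lap Vopen denR fw; have f4 := dfam_lap Vopen denR fr.
  have f5 := dfam_gam Vopen denR fw fr.
  have f6 : Rat (fun d p => rho i d (defining r (A d)) p).
    have f7 := dfam_lap Vopen denR fsgR.
    have f8 : Rat (fun d _ => (d + 1)^-1).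
      exact: (dfam_d1 denR (den_neq0 denr)).
    by rewrite /rho; dfam_arith denR.
  by rewrite /L_rest; dfam_arith denR.
have fLs : Reg (fun d p => Lop i d (s d) (lam d) (U d) p).
  have f1 := dfam_gam Vopen denr fs fU; have f2 := dfam_lap Vopen denr fU.
  have f3 := dfam_rho fs.
  by rewrite /Lop; dfam_arith denr.
exists (fun d p => Lop i d (s d) (lam d) (U d) p),
  (fun d p => k.+1%:R * (d + 2 * lam d - 1 - k%:R) * w d p
     + r p * L_rest i r d (lam d) k (A d) (w d) p + r p ^+ (n - k) * Q1 d p).
split=> //; first by dfam_arith denR.
have nUw : \forall d \near @cofin R, smooth (U d) /\ smooth (w d).
  by apply: filterI; [exact: (dfam_Cinf dS fU) | exact: (dfam_Cinf dS fw)].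
apply: filterS3 near_smooth nUw uE => d [da Cs CW CA] [CU Cw] {}uE p Sp.
split; last first.
  by move=> ->; rewrite expr0n subn_eq0 leqNgt kn !mul0r !addr0.
have Ce : smooth (fun q => r q ^+ k.+1 * w d q).
  by apply: (CinfM dS) Cw; exact: (CinfX dS).
have CW2 : smooth (fun q => r q ^+ n.+2 * W d q).
  by apply: (CinfM dS) CW; exact: (CinfX dS).
have CUe := CinfD dS CU Ce.
have uE' q : S q -> U d q + r q ^+ k.+1 * w d q = u d q by move=> Sq; rewrite uE.
transitivity (Lop i d (sg d) (lam d) (U d) p +
    Lop i d (sg d) (lam d) (fun q => r q ^+ k.+1 * w d q) p).
  rewrite /Lop -(eq_gam Vopen _ CUe uE' Sp) -(eq_lap Vopen CUe uE' Sp) uE //.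
  rewrite (gamDr Vopen _ CU Ce Sp) (lapD Vopen CU Ce Sp).
  set e := (fun q : 'rV[R]_n.+1 => r q ^+ k.+1 * w d q).
  move: (gam (sg d) (U d) p) (gam (sg d) e p) (lap (U d) p) (lap e p).
  by move: (rho _ _ _ _) (sg d p) (J i d p) (U d p) (w d p) (r p ^+ _) => *; ring.
rewrite {2}sgA (Lop_expM Vopen Cr gam_r _ _ _ CA Cw Sp).
have -> : Lop i d (sg d) (lam d) (U d) p =
    Lop i d (s d) (lam d) (U d) p + r p ^+ n * Q1 d p.
  rewrite /Lop rho_split // sgW // (gamC _ (U d) Sp) (gamDr Vopen _ Cs CW2 Sp).
  rewrite (gam_expM Vopen Cr _ _ CW Sp) (gamC (U d) (s d) Sp) /Q1 !exprS.
  move: (gam (s d) (U d) p) (gam (U d) r p) (gam (U d) (W d) p) (lap (U d) p).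
  move: (rho_pole d p) (rho i d (s d) p) (J i d p) (s d p) (W d p) (U d p) (r p).
  by move=> *; ring.
have -> : r p ^+ n = r p ^+ k * r p ^+ (n - k) by rewrite -exprD subnKC // ltnW.
rewrite exprS; move: (L_rest _ _ _ _ _ _ _ _) (Lop _ _ _ _ _ _) (Q1 d p) (w d p).
by move: (r p ^+ (n - k)) (r p) => *; ring.
Qed.

Definition lam_param (j : nat) d : R := (- d - n.+1%:R) / 2 + 1 + j%:R.

Lemma ratfun_lam_param j : ratfun reg (lam_param j).
Proof.
apply: ratfun_eq (ratfun_poly denr ((- 'X - n.+1%:R%:P) * (2^-1)%:P + 1 + j%:R%:P)).
by apply: nearW => d; rewrite !hornerE.
Qed.

(** The factors of L with j = n-1, ..., n-m have been applied.  With lam = lam_j the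
    leading factor is (j+1) (d + 2 lam - 1 - j) = - (j+1) (n-j), whose products are
    (-1)^m m! n (n-1) ... (n-m+1). *)
Lemma Q_iterate m : (m <= n)%N -> exists U w, [/\ Reg U, Rat w &
  \forall d \near @cofin R, forall p, S p ->
    foldr (fun (j : nat) u => Lop i d (sg d) (lam_param j d) u)
      (fun q => (n.+1%:R - 1) * rho i d (sg d) q - sg d q * J i d q)
      (iota (n - m) m) p = U d p + r p ^+ (n - m) * w d p /\
    (r p = 0 -> w d p = (-1) ^+ m * m`!%:R * (n ^_ m)%:R *
       (- (n%:R * n.+2%:R * n.+1%:R) * W d p * (d + 1)^-1))].
Proof.
elim: m => [|m IH] mn.
  rewrite subn0 /=; have [U [w [fU fw E]]] := Q_start; exists U, w; split=> //.
  apply: filterS E => d E p Sp; have [e w0] := E p Sp; split=> // rp.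
  by rewrite w0 // ffactn0 fact0 expr0 !mul1r.
have [U [w [fU fw E]]] := IH (ltnW mn).
have kE : (n - m = (n - m.+1).+1)%N by rewrite subnSK.
rewrite kE in E.
pose u d := foldr (fun (j : nat) u => Lop i d (sg d) (lam_param j d) u)
      (fun q => (n.+1%:R - 1) * rho i d (sg d) q - sg d q * J i d q)
      (iota (n - m.+1).+1 m).
have kn : (n - m.+1 < n)%N by rewrite ltn_subrL n_gt0.
have uE : \forall d \near @cofin R, forall p, S p ->
    u d p = U d p + r p ^+ (n - m.+1).+1 * w d p.
  by apply: filterS E => d E p Sp; case: (E p Sp).
have [U' [w' [fU' fw' E']]] := Lop_step (ratfun_lam_param (n - m.+1)) kn fU fw uE.
exists U', w'; split=> //; apply: filterS2 E E' => d E E' p Sp.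
have [e w0'] := E' p Sp; split=> [|rp]; first exact: e.
have [_ w0] := E p Sp.
rewrite w0' // w0 // ffactnSr factS natrM exprS !natrM /lam_param.
have -> : (n - m.+1).+1%:R = (n - m)%:R :> R by rewrite -kE.
have -> : (n - m.+1)%:R = n%:R - m%:R - 1 :> R.
  by rewrite natrB // -natr1; ring.
rewrite natrB ?(ltnW mn) // -[n.+1%:R]natr1 -[m.+1%:R]natr1.
by move: (d + 1)^-1 ((-1) ^+ m) => *; field.
Qed.

End QStep.

(** * The coefficients of the formal solution *)
Section Coefficients.
Context (R : realType) (n : nat) (X : topologicalType) (g : riemannian R n X)
  (eps : R) (V : set X) (kap : R -> X -> X) (pi : X -> X).
Hypothesis coords : geodesic_normal_coordinates g eps V kap pi.
Hypothesis n_gt0 : (0 < n)%N.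
Context (cB : nat -> X -> R) (RemB : X -> R).
Hypothesis CcB : forall k, (2 <= k <= n.+1)%N -> Cinf_bd g (cB k).
Hypothesis CRemB : Cinf_on g V RemB.
Hypothesis SB : S_expansion g V n%:R (sigma_poly g pi n.+1 cB) n.+1 RemB.
Context (c : nat -> R -> X -> R).
Hypothesis c_sol : formal_solution g V pi n.+1 c.

Local Notation H := (@halfspace R n).
Local Notation S i := (phi g i @` (dom g i `&` V)).
Local Notation a := (n%:R : R).
Local Notation reg := (nonvanishing a).
Local Notation r i := (rdist g \o psi g i).
Local Notation y i p := (pi (psi g i p)).
Let Vopen : open V := gnc_open coords.
Let dS i : reldom H (S i) := chart_reldom Vopen i.
Let denr : denominators reg := den_nonvanishing a.

(** The expansion that defines the obstruction ends with r^(n+1); a zero coefficient of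
    r^(n+2) makes it comparable with the formal solution term by term. *)
Definition cB0 k x := if (k <= n.+1)%N then cB k x else 0.

Definition eta k d x := c k d x - cB0 k x.

Lemma Cinf_bd_cst b : Cinf_bd g (fun=> b).
Proof. by move=> i; apply: (Cinf_cst (reldom_open (@bdset_open _ _ _ g i))). Qed.

Lemma Cinf_cB0 k : (2 <= k)%N -> Cinf_bd g (cB0 k).
Proof.
move=> k2; rewrite /cB0; case: leqP => kn; last exact: Cinf_bd_cst.
by apply: CcB; rewrite k2.
Qed.

Lemma eta_bdfam k : (2 <= k <= n.+2)%N -> bdfam g (@nonzero R) (eta k).
Proof.
move=> kn; have [crat _] := c_sol.
have b1 := rational_bdfam (Cinf_bd_cst 0) (crat _ kn).
have b2 : bdfam g (@nonzero R) (fun d x => cB0 k x * -1).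
  apply: bdfam1 (ratfun_cst (@den_nonzero R) (-1)).
  by apply: Cinf_cB0; case/andP: kn.
by apply: eq_bdfam (bdfamD b1 b2); apply: nearW => d x _; rewrite mulrN1.
Qed.

Section Chart.
Variable i : chart g.

Lemma Cinf_r : Cinf H (S i) (r i).
Proof. exact: (Cinf_on_rdist coords). Qed.

Lemma gam_r p : S i p -> nabla_grad i (r i) (r i) p = 1.
Proof. exact: (gam_rdist coords). Qed.

Lemma Cinf_y u : Cinf_bd g u -> Cinf H (S i) (fun p => u (y i p)).
Proof. by move=> Cu; exact: (Cinf_on_pi coords Cu). Qed.

Lemma y_bd p : S i p -> bd g (y i p).
Proof. by move=> /chartP[x [_ Vx _ ->]]; case: (gnc_onto coords Vx). Qed.

Lemma bdfam_dfam U F : denominators U -> bdfam g U F ->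
  dfam H (S i) U (fun d p => F d (y i p)).
Proof.
move=> denU; elim=> {F} [u b Cu Kb|F G _ fF _ fG|F G FG _ fF].
- by apply: dfamM; [apply: dfam_smooth; exact: Cinf_y | exact: dfam_scalar].
- exact: dfamD.
apply: eq_in_dfam fF; apply: filterS FG => d FG p Sp; apply: FG; exact: y_bd.
Qed.

Definition sB p := r i p + \sum_(2 <= l < n.+3) cB0 l (y i p) * r i p ^+ l.
(** The deviations of orders below K divided by d - n, which is regular for the orders
    that are already known to deviate by a multiple of d - n. *)
Definition tau K d p :=
  \sum_(2 <= l < K) (d - a)^-1 * eta l d (y i p) * r i p ^+ l.
Definition Acoef K d p :=
  \sum_(2 <= l < n.+3) cB0 l (y i p) * r i p ^+ (l - 2)
  + \sum_(2 <= l < K) eta l d (y i p) * r i p ^+ (l - 2).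
Definition Bcoef K d p := \sum_(K <= l < n.+3) eta l d (y i p) * r i p ^+ (l - K).

Let exp_sub k l p : (k <= l)%N -> r i p ^+ l = r i p ^+ k * r i p ^+ (l - k).
Proof. by move=> kl; rewrite -exprD subnKC. Qed.

Lemma defining_Acoef K d : d - a != 0 ->
  defining (r i) (Acoef K d) = fun p => sB p + (d - a) * tau K d p.
Proof.
move=> da; apply/funext => p; rewrite /defining /sB /tau /Acoef mulrDr !mulr_sumr.
rewrite -addrA; congr (_ + (_ + _)); apply: eq_big_nat => l /andP[l2 _];
  rewrite (exp_sub p l2) /=; first by ring.
by field.
Qed.

Lemma sigma_split K d : (2 <= K <= n.+3)%N ->
  sigma_poly g pi n.+2 (fun k => c k d) \o psi g i =
  fun q => defining (r i) (Acoef K d) q + r i q ^+ K * Bcoef K d q.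
Proof.
move=> /andP[K2 Kn]; apply/funext => p; rewrite /sigma_poly /defining /Acoef /Bcoef /=.
rewrite -addrA; congr (_ + _).
transitivity (\sum_(2 <= l < n.+3) cB0 l (y i p) * r i p ^+ l +
              \sum_(2 <= l < n.+3) eta l d (y i p) * r i p ^+ l).
  rewrite -big_split; apply: eq_big_nat => l _ /=; rewrite /eta; ring.
rewrite mulrDr -!addrA; congr (_ + _).
  rewrite mulr_sumr; apply: eq_big_nat => l /andP[l2 _].
  by rewrite (exp_sub p l2) /=; ring.
rewrite (big_cat_nat K2 Kn) /= !mulr_sumr; congr (_ + _);
  apply: eq_big_nat => l /andP[l2 _];
  by rewrite (exp_sub p l2) /=; ring.
Qed.

Lemma sB_sigma : sB = sigma_poly g pi n.+1 cB \o psi g i.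
Proof.
apply/funext => p; rewrite /sB /sigma_poly /= big_nat_recr //= /cB0 ltnn mul0r addr0.
by congr (_ + _); apply: eq_big_nat => l /andP[_ ln]; rewrite -ltnS ln.
Qed.

Lemma dfam_r U : dfam H (S i) U (fun _ p => r i p).
Proof. by apply: dfam_smooth; exact: Cinf_r. Qed.

Lemma Cinf_sB : Cinf H (S i) sB.
Proof.
apply: (CinfD (dS i)); first exact: Cinf_r.
apply: (eq_Cinf (dS i) _ (_ : Cinf H (S i) (fun p =>
   \sum_(2 <= l < n.+3 | (2 <= l)%N) cB0 l (y i p) * r i p ^+ l))).
  move=> p _; rewrite [RHS]big_nat_cond [LHS]big_nat_cond; apply: eq_bigl => l.
  by case: (2 <= l)%N; rewrite ?andbF.
apply: (Cinf_sum (dS i)) => l l2; apply: (CinfM (dS i)).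
  by apply: Cinf_y; exact: Cinf_cB0.
by apply: (CinfX (dS i)); exact: Cinf_r.
Qed.

Lemma dfam_coef U lo K (F : nat -> R -> X -> R) k : denominators U ->
  (forall l, (lo <= l < K)%N -> bdfam g U (F l)) ->
  dfam H (S i) U (fun d p => \sum_(lo <= l < K) F l d (y i p) * r i p ^+ (l - k)).
Proof.
move=> denU bF; apply: (dfam_sum denU) => l; rewrite mem_index_iota => lK.
apply: dfamM; first by apply: bdfam_dfam => //; exact: bF.
by apply: (dfamX denU); exact: dfam_r.
Qed.

Lemma eta_bdfam_in lo hi l : (2 <= lo)%N -> (hi <= n.+3)%N -> (lo <= l < hi)%N ->
  bdfam g (@nonzero R) (eta l).
Proof.
move=> l2 hn /andP[lol lh]; apply: eta_bdfam.
by rewrite (leq_trans l2 lol) -ltnS (leq_trans lh hn).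
Qed.

Lemma dfam_tau K :
  (forall l, (2 <= l < K)%N -> bdfam g reg (fun d z => (d - a)^-1 * eta l d z)) ->
  dfam H (S i) reg (tau K).
Proof.
move=> beta; apply: eq_in_dfam (dfam_coef 0 denr beta).
by apply: nearW => d p _; apply: eq_bigr => l _; rewrite subn0.
Qed.

Lemma dfam_Acoef K : (K <= n.+3)%N -> dfam H (S i) (@nonzero R) (Acoef K).
Proof.
move=> Kn; apply: dfamD; last first.
  by apply: (dfam_coef 2 (@den_nonzero R)) => l; exact: eta_bdfam_in.
apply: (dfam_coef (F := fun l _ => cB0 l) 2 (@den_nonzero R)) => l /andP[l2 _].
apply: eq_bdfam (bdfam1 (Cinf_cB0 l2) (ratfun_cst (@den_nonzero R) 1)).
by apply: nearW => d z _; rewrite mulr1.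
Qed.

(** Split sigma as sigma_B + (d-n) tau + r^(k+2) B, where sigma_B is the solution for
    d = n and B starts with the deviation of order k+2.  Compare the coefficients of
    r^(k+1) in S(sigma) = 1 + O(r^(n+2)): sigma_B contributes the obstruction if k = n and
    nothing otherwise, (d-n) tau contributes a regular multiple of d - n, and the
    deviation enters through the leading term of [Sop_perturb]. *)
Lemma eta_recursion k x : (k <= n)%N -> bd g x -> dom g i x ->
  (forall l, (2 <= l < k.+2)%N -> bdfam g reg (fun d z => (d - a)^-1 * eta l d z)) ->
  exists b, ratfun reg b /\ \forall d \near @cofin R,
    (2 * k.+2%:R - 2 * k.+2%:R * k.+1%:R / (d + 1)) * (k.+1)`!%:R * eta k.+2 d x =
    - ((d - a) * b d) - (if k == n then (n.+1)`!%:R * RemB x else 0).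
Proof.
move=> kn bx dx beta.
have Sx : S i (phi g i x) by exists x => //; split=> //; exact: (gnc_bd coords).
have [CE [finE Esol]] : exists E : set R, finite_set E /\ forall d, ~ E d ->
    exists2 Rem : X -> R, Cinf_on g V Rem &
      S_expansion g V d (sigma_poly g pi n.+2 (fun k => c k d)) n.+2 Rem.
  by have [_] := c_sol.
have ft := dfam_tau beta.
have fB : dfam H (S i) (@nonzero R) (Bcoef k.+2).
  by apply: (dfam_coef k.+2 (@den_nonzero R)) => l; exact: eta_bdfam_in.
have fA : dfam H (S i) (@nonzero R) (Acoef k.+2) by apply: dfam_Acoef; rewrite !ltnS ltnW.
have [G [fG SG]] := Sop_shift Vopen n_gt0 Cinf_sB ft.
have frG : dfam H (S i) reg (fun d p => radial i (r i) k.+1 (G d) p).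
  elim: k.+1 => [|j IH] //=.
  by apply: (dfam_gam Vopen denr) IH; exact: dfam_r.
exists (fun d => radial i (r i) k.+1 (G d) (phi g i x)); split.
  exact: (dfam_at denr frG Sx).
have CB := dfam_Cinf (dS i) fB; have CA := dfam_Cinf (dS i) fA.
have CG := dfam_Cinf (dS i) fG.
have nE : \forall d \near @cofin R, ~ CE d.
  by rewrite /prop_near1 /nbhs /= /cofin; apply: sub_finite_set finE => d /= /contrapT.
have da := cofin_neq a; have d1 := cofin_neq (-1 : R).
near=> d.
have dan : d - a != 0 by near: d.
have [Rem CRem Seq] : exists2 Rem : X -> R, Cinf_on g V Rem &
    S_expansion g V d (sigma_poly g pi n.+2 (fun k => c k d)) n.+2 Rem.
  by apply: Esol; near: d.
have CBd : Cinf H (S i) (Bcoef k.+2 d) by near: d; exact: CB.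
have CAd : Cinf H (S i) (Acoef k.+2 d) by near: d; exact: CA.
have CGd : Cinf H (S i) (G d) by near: d; exact: CG.
have SGd : forall p, S i p -> Sop i d (fun q => sB q + (d - a) * tau k.+2 d q) p =
    Sop i a sB p + (d - a) * G d p by near: d; exact: SG.
have kr : (2 <= k.+2 <= n.+3)%N by rewrite /= !ltnS ltnW.
set mu := 2 * k.+2%:R - 2 * k.+2%:R * k.+1%:R / (d + 1).
(* The terms of the equation, each of the form for which the radial derivative of
   order k+1 on M is known. *)
pose f1 q := r i q ^+ k.+1 * (mu * Bcoef k.+2 d q).
pose f2 q := r i q ^+ k.+2 * S_rest i (r i) d k (Acoef k.+2 d) (Bcoef k.+2 d) q.
pose f3 q := (d - a) * G d q.
pose f4 q := r i q ^+ n.+1 * RemB (psi g i q).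
pose f5 q := r i q ^+ n.+2 * (-1 * Rem (psi g i q)).
have f0 q : S i q -> f1 q + (f2 q + (f3 q + (f4 q + f5 q))) = 0 * G d q.
  move=> Sq; have [z [dz Vz zq qz]] := chartP Sq.
  have := Seq i z Vz dz; rewrite (sigma_split d kr) zq.
  rewrite (Sop_perturb Vopen Cinf_r gam_r) // defining_Acoef // SGd //.
  have := SB Vz dz; rewrite zq -sB_sigma => ->.
  rewrite -/mu /f1 /f2 /f3 /f4 /f5 qz /= qz => e.
  move/eqP: e; rewrite -subr_eq0 => /eqP e; rewrite mul0r -e; ring.
have Cr := Cinf_r.
have rx : r i (phi g i x) = 0 by rewrite /= phiK // (rdist_bd coords).
have CX j u : Cinf H (S i) u -> Cinf H (S i) (fun q => r i q ^+ j * u q).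
  by move=> Cu; apply: (CinfM (dS i)) Cu; exact: (CinfX (dS i)).
have Cc b := Cinf_cst (dS i) b.
have Cf1' := CinfM (dS i) (Cc mu) CBd.
have Cf1 : Cinf H (S i) f1 := CX k.+1 _ Cf1'.
have Cf2' := Cinf_S_rest Vopen Cr d k CAd CBd.
have Cf2 : Cinf H (S i) f2 := CX k.+2 _ Cf2'.
have Cf3 : Cinf H (S i) f3 := CinfM (dS i) (Cc (d - a)) CGd.
have Cf4' : Cinf H (S i) (fun q => RemB (psi g i q)) := @CRemB i.
have Cf4 : Cinf H (S i) f4 := CX n.+1 _ Cf4'.
have Cf5' : Cinf H (S i) (fun q => -1 * Rem (psi g i q)) :=
  CinfM (dS i) (Cc (-1)) (CRem i).
have Cf5 : Cinf H (S i) f5 := CX n.+2 _ Cf5'.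
have C45 := CinfD (dS i) Cf4 Cf5; have C35 := CinfD (dS i) Cf3 C45.
have C25 := CinfD (dS i) Cf2 C35; have C15 := CinfD (dS i) Cf1 C25.
have := eq_radial Vopen Cr k.+1 C15 f0 Sx.
rewrite (radialZ Vopen Cr) // mul0r.
rewrite (radialD Vopen Cr _ Cf1 C25) // (radialD Vopen Cr _ Cf2 C35) //.
rewrite (radialD Vopen Cr _ Cf3 C45) // (radialD Vopen Cr _ Cf4 Cf5) //.
rewrite (radial_top Vopen Cr gam_r _ Cf1' Sx rx).
rewrite (radial_low Vopen Cr gam_r (ltnSn _) Cf2' Sx rx).
rewrite (radialZ Vopen Cr _ _ CGd Sx).
rewrite (radial_low Vopen Cr gam_r (_ : (k.+1 < n.+2)%N) Cf5' Sx rx) //.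
have -> : radial i (r i) k.+1 f4 (phi g i x) =
    if k == n then (n.+1)`!%:R * RemB x else 0.
  case: eqVneq => [->|kn'].
    by rewrite (radial_top Vopen Cr gam_r _ Cf4' Sx rx) phiK.
  by rewrite (radial_low Vopen Cr gam_r _ Cf4' Sx rx) // !ltnS ltn_neqAle kn'.
have -> : Bcoef k.+2 d (phi g i x) = eta k.+2 d x.
  rewrite /Bcoef big_ltn ?ltnS // subnn expr0 mulr1 phiK // (pi_bd coords) //.
  rewrite big_nat big1 ?addr0 // => l /andP[kl _].
  by rewrite rx expr0n subn_eq0 leqNgt kl mulr0.
set t := radial _ _ _ _ _; set w := if _ then _ else _.
move=> e; apply/eqP; rewrite -subr_eq0; apply/eqP; rewrite -[RHS]e; ring.
Unshelve. all: by end_near.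
Qed.

End Chart.

Lemma ratfun_shift_sub k : ratfun reg (fun d => d - k).
Proof.
apply: ratfun_eq (ratfun_poly denr ('X - k%:P)).
by apply: nearW => d; rewrite hornerXsubC.
Qed.

(** For k < n the factor 2 (k+2) (d-k) / (d+1) is invertible at d = n, so by induction
    the deviation of order k+2 is (d-n) times a function regular at d = n, first
    at each point and then as a family. *)
Lemma eta_regular k : (2 <= k <= n.+1)%N ->
  bdfam g reg (fun d z => (d - a)^-1 * eta k d z).
Proof.
elim/ltn_ind: k => -[|[|k]] // IH /= kn.
have Kinv : ratfun (@nonzero R) (fun d => (d - a)^-1).
  have U : nonzero ('X - a%:P) by exact: monic_neq0 (monicXsubC a).
  by apply: ratfun_eq (ratfunV U); apply: nearW => d; rewrite hornerXsubC.
apply: bdfam_regular => [|x bx].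
  by apply: (bdfamZ (@den_nonzero R) Kinv); apply: eta_bdfam; rewrite /= ltnS ltnW.
have [i dx] := dom_cover g x.
have kn' : (k < n)%N by rewrite -ltnS.
have [|b [Kb bE]] := eta_recursion (ltnW kn') bx dx.
  by move=> l /andP[l2 lk]; apply: IH => //; rewrite l2 (leq_trans _ kn) // ltnW.
have kU : reg ('X - k%:R%:P).
  by rewrite /nonvanishing hornerXsubC subr_eq0 eqr_nat gtn_eqF.
have K1 := ratfunM denr (ratfunM denr Kb (ratfun_shift_sub (-1)))
  (ratfunM denr (ratfun_cst denr (- (2 * k.+2%:R * (k.+1)`!%:R)^-1)) (ratfunV kU)).
apply: ratfun_eq K1.
have dk := cofin_neq (k%:R : R); have da := cofin_neq a; have d1 := cofin_neq (-1 : R).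
apply: filterS2 bE (filterI dk (filterI da d1)) => d.
rewrite (ltn_eqF kn') subr0 => e [dk0 [da0 d10]].
rewrite hornerXsubC; rewrite opprK in d10 *.
have f0 : (k.+1)`!%:R != 0 :> R by rewrite pnatr_eq0 -lt0n fact_gt0.
have k0 : k.+2%:R != 0 :> R by rewrite pnatr_eq0.
have e' : eta k.+2 d x = - ((d - a) * b d) * (d + 1)
    / (2 * k.+2%:R * (k.+1)`!%:R * (d - k%:R)).
  rewrite -e -[k.+1%:R]natr1.
  move: (k.+2%:R) k0 ((k.+1)`!%:R) f0 (eta k.+2 d x) => K2 k0 f f0 t; field.
  by rewrite dk0 f0 d10 k0.
rewrite e'; move: (k.+2%:R) k0 ((k.+1)`!%:R) f0 => K2 k0 f f0; field.
by rewrite dk0 da0 f0 k0.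
Qed.

(** For k = n the factor 2 (n+2) (d-n) / (d+1) vanishes at d = n, so the
    deviation of order n+2 needs a simple pole to cancel the obstruction. *)
Lemma eta_top x : bd g x -> exists h, ratfun reg h /\ \forall d \near @cofin R,
  eta n.+2 d x = - (d + 1) / (2 * n.+2%:R) * (RemB x / (d - a) + h d).
Proof.
move=> bx; have [i dx] := dom_cover g x.
have [|b [Kb bE]] := eta_recursion (leqnn n) bx dx.
  by move=> l lk; exact: eta_regular.
exists (fun d => (n.+1)`!%:R^-1 * b d); split.
  exact: (ratfunM denr (ratfun_cst denr _) Kb).
have da := cofin_neq a; have d1 := cofin_neq (-1 : R).
apply: filterS2 bE (filterI da d1) => d; rewrite eqxx opprK => e [da0 d10].
have f0 : (n.+1)`!%:R != 0 :> R by rewrite pnatr_eq0 -lt0n fact_gt0.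
have k0 : n.+2%:R != 0 :> R by rewrite pnatr_eq0.
have -> : RemB x = (- ((d - a) * b d) -
   (2 * n.+2%:R - 2 * n.+2%:R * n.+1%:R / (d + 1)) * (n.+1)`!%:R * eta n.+2 d x)
   / (n.+1)`!%:R.
  by rewrite e; move: ((n.+1)`!%:R) f0 => f f0; field.
rewrite -[n.+1%:R]natr1.
move: (n.+2%:R) k0 ((n.+1)`!%:R) f0 (eta n.+2 d x) => K2 k0 f f0 t; field.
by rewrite da0 f0 d10 k0.
Qed.

(** The residue - (n+1) B / (2 (n+2)) of the coefficient of r^(n+2) is multiplied
    by - n (n+1) (n+2) / (n+1) from (N-1) rho, by (-1)^n n! n! from the operators L, and
    by the sign in the definition of Q. *)
Lemma Q_principal_part (i : chart g) x : bd g x -> dom g i x ->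
  exists h, ratfun reg h /\ \forall d \near @cofin R,
  Qext i n.+1 d (sigma_poly g pi n.+2 (fun k => c k d) \o psi g i) (phi g i x) =
  (-1) ^+ n.-1 * n`!%:R * (n.+1)`!%:R * (n%:R / 2) * RemB x / (d - a) + h d.
Proof.
move=> bx dx.
have Sx : S i (phi g i x) by exists x => //; split=> //; exact: (gnc_bd coords).
pose A := Acoef i n.+3.
have fA : dfam H (S i) (@nonzero R) A by exact: dfam_Acoef.
have ft : dfam H (S i) reg (tau i n.+2) by apply: dfam_tau => l lk; exact: eta_regular.
pose s d p := sB i p + (d - a) * tau i n.+2 d p.
have fs : dfam H (S i) reg s.
  apply: dfamD; first by apply: dfam_smooth; exact: Cinf_sB.
  by apply: dfamM ft; apply: dfam_scalar; exact: ratfun_shift_sub.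
pose W d p := eta n.+2 d (y i p).
have fW : dfam H (S i) (@nonzero R) W.
  by apply: bdfam_dfam; [exact: den_nonzero | apply: eta_bdfam; rewrite leqnn].
pose sg d := sigma_poly g pi n.+2 (fun k => c k d) \o psi g i.
have sgA d : sg d = defining (r i) (A d).
  rewrite /sg (@sigma_split i n.+3 d) ?leqnn //; apply/funext => q.
  by rewrite /Bcoef big_geq // mulr0 addr0.
have sgW d : d - a != 0 -> sg d = fun q => s d q + r i q ^+ n.+2 * W d q.
  move=> da; rewrite /sg (@sigma_split i n.+2 d) ?leqnSn //; apply/funext => q.
  by rewrite defining_Acoef // /Bcoef big_nat1 subnn expr0 mulr1.
have [U [w [fU fw E]]] :=
  Q_iterate Vopen n_gt0 (@Cinf_r i) (@gam_r i) fA fs fW sgA sgW (leqnn n).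
have [h [Kh hE]] := eta_top bx.
have rx : r i (phi g i x) = 0 by rewrite /= phiK // (rdist_bd coords).
pose C : R := (-1) ^+ n.-1 * n`!%:R * (n.+1)`!%:R * (n%:R / 2).
exists (fun d => -1 * U d (phi g i x) + C * h d); split.
  apply: (ratfunD denr); apply: (ratfunM denr); try exact: (ratfun_cst denr).
    exact: (dfam_at denr fU Sx).
  exact: Kh.
apply: filterS2 (filterI E hE) (cofin_neq (-1 : R)) => d [{}E {}hE]; rewrite opprK => d10.
have [e w0] := E _ Sx.
have k0 : n.+2%:R != 0 :> R by rewrite pnatr_eq0.
transitivity (- (U d (phi g i x) + r i (phi g i x) ^+ (n - n) * w d (phi g i x))).
  by congr (- _); rewrite -e subnn; congr (foldr _ _ _ _).
rewrite subnn expr0 mul1r w0 // /W phiK // (pi_bd coords) // hE.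
rewrite ffactnn /C factS natrM.
(* The sign (-1)^(n-1) of the claim against (-1)^n from the n operators L. *)
have -> : (-1) ^+ n = - (-1) ^+ n.-1 :> R by rewrite -{1}(prednK n_gt0) exprS mulN1r.
move: ((-1) ^+ n.-1) (n`!%:R) (U _ _) (h d) (d - a)^-1 (n.+2%:R) k0 (n.+1%:R).
move=> e0 f u hd t K2 k0 K1; field.
by rewrite d10 k0.
Qed.
End Coefficients.

Theorem theorem11p6 (R : realType) (n N : nat) (X : topologicalType)
  (g : riemannian R n X) (eps : R) (V : set X) (kap : R -> X -> X) (pi : X -> X)
  (Bn : X -> R) (c : nat -> R -> X -> R)
  (n_even : ~~ odd n) (N_def : N = n.+1) (N_ge3 : (3 <= N)%N)
  (X_compact : compact [set: X])
  (coords : geodesic_normal_coordinates g eps V kap pi)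
  (Bn_def : is_obstruction g V pi Bn)
  (c_def : formal_solution g V pi N c) :
  forall (i : chart g) (x : X), bd g x -> dom g i x ->
    is_residue
      (fun d : R =>
         Qext i N d (sigma_poly g pi N.+1 (fun k => c k d) \o psi g i)
           (phi g i x))
      (N%:R - 1)
      ((-1) ^+ n.-1 * n`!%:R * (n.+1)`!%:R * (n%:R / 2) * Bn x).
Proof.
move=> i x bx dx; subst N.
have n_gt0 : (0 < n)%N by rewrite -ltnS ltnW.
have [cB [Rem [CcB CRem SB BnE]]] := Bn_def.
have [h [[P [Q [Qn hE]]] QE]] := Q_principal_part coords n_gt0 CcB CRem SB c_def bx dx.
have -> : n.+1%:R - 1 = n%:R :> R by rewrite -natr1 addrK.
exists 0%N, (fun=> 0), P, Q.
have QE' := filterI hE QE.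
exists (~` [set d | h d = P.[d] / Q.[d] /\
  Qext i n.+1 d (sigma_poly g pi n.+2 (fun k => c k d) \o psi g i) (phi g i x) =
  (-1) ^+ n.-1 * n`!%:R * (n.+1)`!%:R * (n%:R / 2) * Rem x / (d - n%:R) + h d]).
split=> [||d]; [exact: Qn | exact: QE' | rewrite /setC /= => /contrapT[<- ->]].
by rewrite big_geq // addr0 BnE.
Qed.
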